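(* Let $1<p<2<q<\infty$ satisfy $$\frac1p\ \ge\ \frac1q\log_2\binom{q}{q/2}.$$ Let $N\ge 1$ be an integer, and for $j=0,1,\dots,N$ let $$G_j=\begin{pmatrix}A_j&B_j\\ \overline{B_j}&\overline{A_j}\end{pmatrix}\in\mathrm{SU}(1,1).$$ For $j=1,\dots,N$ and $s\in\mathbb{T}$ set $\widetilde G_j(s):=D(s)G_jD(s)^{-1}$. For $t=(t_1,\dots,t_N)\in\mathbb{T}^N$ let $$Q_N(t):=G_0\,\widetilde G_1(t_1)\cdots\widetilde G_N(t_N),$$ and let $a_N(t)$ be the upper-left entry of $Q_N(t)$. Then $$\left\|\bigl(\log|a_N|^2\bigr)^{1/2}\right\|_{L^q(\mathbb{T}^N)}\le\left(\sum_{j=0}^{N}\bigl(\log|A_j|^2\bigr)^{p/2}\right)^{1/p}.$$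
   Context: $\mathbb{T}=\mathbb{R}/\mathbb{Z}$ with normalized Haar measure, $\mathbb{T}^N$ with the product measure; $\log$ is the natural logarithm. For real $q>2$, $\binom{q}{q/2}:=\Gamma(q+1)/\Gamma(q/2+1)^2$. $\mathrm{SU}(1,1)$ is the group of complex matrices $\begin{pmatrix}A&B\\ \overline{B}&\overline{A}\end{pmatrix}$ with $|A|^2-|B|^2=1$. For $s\in\mathbb{R}$, $D(s):=\begin{pmatrix}e^{\pi i s}&0\\0&e^{-\pi i s}\end{pmatrix}$; conjugation $D(s)GD(s)^{-1}$ depends only on $s$ modulo $1$. *)

(* Defs.v *)
From HB Require Import structures.
From mathcomp Require Import all_boot all_order all_algebra.
From mathcomp Require Import complex.
From mathcomp Require Import all_classical all_reals all_analysis.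

Set Implicit Arguments.
Unset Strict Implicit.
Unset Printing Implicit Defensive.

Import Order.TTheory GRing.Theory Num.Theory Normc.

Local Open Scope classical_set_scope.
Local Open Scope ring_scope.

(* Euler's integral; it converges only for 0 < x. *)
Definition Gamma {R : realType} (x : R) : R :=
  (\int[lebesgue_measure]_(t in `]0, +oo[) (t `^ (x - 1) * expR (- t)))%R.

(* the generalized binomial coefficient "q choose q/2" *)
Definition central_binomial {R : realType} (q : R) : R :=
  Gamma (q + 1) / Gamma (q / 2 + 1) ^+ 2.

Definition log2 {R : realType} (x : R) : R := ln x / ln 2.

Section tuple_prob.
Context d (T : measurableType d) (R : realType) (P : probability T R).

Definition tcons n (x : T * n.-tuple T) : n.+1.-tuple T :=
  [tuple of x.1 :: x.2].

Lemma measurable_tcons n : measurable_fun [set: T * n.-tuple T] (@tcons n).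
Proof. by apply: measurable_cons. Qed.

HB.instance Definition _ n :=
  isMeasurableFun.Build _ _ _ _ (@tcons n) (@measurable_tcons n).

(* The n-fold product measure of P on n.-tuple T, the library having only
   binary products: P^(n+1) is the image of P \x P^n under tcons. It is
   characterized by tuple_prob_box. *)
Fixpoint tuple_prob n : probability (n.-tuple T) R :=
  if n is m.+1 then distribution (P \x tuple_prob m)%E (@tcons m)
  else \d_([tuple] : 0.-tuple T).

Lemma tuple_prob_box n (A : 'I_n -> set T) :
  (forall i, measurable (A i)) ->
  (tuple_prob n [set t | forall i, A i (tnth t i)] =
   \prod_(i < n) P (A i))%E.
Proof.
elim: n A => [|n IH] A mA.
  rewrite big_ord0 /= diracE mem_set//.
  by case.
rewrite big_ord_recl -IH//= /distribution /pushforward.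
rewrite [X in (P \x _)%E X](_ : _ =
  A ord0 `*` [set t | forall i, A (lift ord0 i) (tnth t i)]).
  rewrite product_measure1E//.
  rewrite [X in measurable X](_ : _ = \bigcap_(i in [set: 'I_n])
    ((fun t => tnth t i) @^-1` A (lift ord0 i))); last first.
    apply/seteqP; split => t /= h i => [_|]; exact: h.
  apply: fin_bigcap_measurable => // i _.
  rewrite -[X in measurable X]setTI.
  exact: measurable_tnth.
apply/seteqP; split => [[x t] /= h|[x t] [/= h0 h] i].
  split=> [|i]; first exact: (h ord0).
  by have := h (lift ord0 i); rewrite tnthS.
by case: (unliftP ord0 i) => [j ->|->]; rewrite ?tnthS//.
Qed.

End tuple_prob.

(* Lebesgue measure on [0, 1], i.e. the Haar measure of the circle read on real
   representatives *)
Definition circle_prob (R : realType) : probability (measurableTypeR R) R :=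
  uniform_prob (@ltr01 R).

Definition torus_prob (R : realType) (N : nat) : probability (N.-tuple (measurableTypeR R)) R :=
  tuple_prob (circle_prob R) N.

Section su11.
Context {R : realType}.
Local Open Scope complex_scope.

Definition mx2 (a b c d : R[i]) : 'M[R[i]]_2 :=
  \matrix_(i, j) if i == 0 then (if j == 0 then a else b)
                 else (if j == 0 then c else d).

Definition SU11 : set 'M[R[i]]_2 :=
  [set G | exists A B : R[i],
    G = mx2 A B B^* A^* /\ normc A ^+ 2 - normc B ^+ 2 = 1].

Definition expi (x : R) : R[i] := cos x +i* sin x.

Definition Dmx (s : R) : 'M[R[i]]_2 :=
  mx2 (expi (pi * s)) 0 0 (expi (- (pi * s))).

Definition conjD (G : 'M[R[i]]_2) (s : R) : 'M[R[i]]_2 := Dmx s * G * (Dmx s)^-1.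

(* conjD G is a function on the circle *)
Lemma conjD_periodic G s : conjD G (s + 1) = conjD G s.
Proof.
have DmxN : Dmx (s + 1) = - Dmx s.
  apply/matrixP => i j; rewrite !mxE mulrDr mulr1 opprD.
  have Npi x : cos (x - pi) = - cos x /\ sin (x - pi) = - sin x :> R.
    by rewrite -{2 4}[x](subrK pi) cosDpi sinDpi !opprK.
  case: (Npi (- (pi * s))) => e1 e2.
  by do 2![case: ifP => _]; rewrite ?oppr0// /expi ?cosDpi ?sinDpi ?e1 ?e2.
by rewrite /conjD DmxN invrN mulrN !mulNr opprK.
Qed.

Definition transfer N (G : 'I_N.+1 -> 'M[R[i]]_2) (t : N.-tuple R) :
    'M[R[i]]_2 :=
  G ord0 * \prod_(j < N) conjD (G (lift ord0 j)) (tnth t j).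

(* log |z|^2, as a real number *)
Definition logsq (z : R[i]) : R := ln (normc z ^+ 2).

End su11.

(* Main.v *)
Require Import Defs.
From mathcomp Require Import all_boot all_order all_algebra.
From mathcomp Require Import complex ring lra.
From mathcomp Require Import all_classical all_reals all_analysis measurable_realfun.

(* Peeling off t_1 replaces (G_0, G_1) by the single matrix G_0 D(t_1) G_1 D(-t_1)
   of SU(1,1), so by induction on N and Minkowski's inequality in L^(q/p) only the
   case N = 1 is needed. With u = log|A_0|^2, v = log|A_1|^2 and
   r^2 = (1 - e^-u)(1 - e^-v), one has, up to a rotation of the circle,
   log|a_1|^2 = u + v + log|1 + r e(t)|^2.

   This is compared with the linear expression |sqrt u + sqrt v e(t)|^2. As functions
   of c = cos(2 pi t), the difference of the two is concave, and nonnegative at c = -1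
   (s |-> log(1 - exp(-e^s)) is concave), so it changes sign at most once, from + to -.
   As its mean is at most 0 (Jensen's formula), convexity of x^(q/2) gives
   ||log|a_1|^2||_(q/2) <= || |sqrt u + sqrt v e|^2 ||_(q/2).

   It remains to show, with s = q/2 and m = p/2, that
   int |sqrt u + sqrt v e|^(2s) <= (u^m + v^m)^(s/m).
   For u/v = e^(2T) this reads N_s(cosh T) <= 2^(s/m - s) cosh(mT)^(s/m), where
   N_s(h) = int (h + cos)^s is a Legendre function. It holds at T = 0 by hypothesis
   (both 2^s N_s(1) and the central binomial obey the same recurrence in s and have
   the same growth). Let D be the difference of the logarithms. D is negative near
   infinity and tends to 0 there, and at a critical point of D the sign of D'' is that
   of s sinh((2m - 1)T) - m sinh T by the Legendre recurrence. If D were positive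
   somewhere, it would have a local maximum at some T_0 and a local minimum at some
   T_1 > T_0, contradicting that sinh((2m - 1)T) / sinh T decreases. *)

Set Implicit Arguments.
Unset Strict Implicit.
Unset Printing Implicit Defensive.

Import Order.TTheory GRing.Theory Num.Theory.
Import numFieldNormedType.Exports.

Local Open Scope classical_set_scope.
Local Open Scope ring_scope.

(** * Averages over the circle *)

Section circle_average.
Context {R : realType}.
Notation mu := (@lebesgue_measure R).
Implicit Types f g F : R -> R.

Lemma continuous_integrable_itv f a b : continuous f ->
  mu.-integrable `[a, b] (EFin \o f).
Proof.
move=> cf; apply: continuous_compact_integrable; first exact: segment_compact.
exact: continuous_subspaceT.
Qed.

Definition avg f : R := \int[mu]_(t in `[0, 1]) f t.

Lemma avgD f g : continuous f -> continuous g ->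
  avg (fun t => f t + g t) = avg f + avg g.
Proof. by move=> cf cg; rewrite /avg RintegralD//; exact: continuous_integrable_itv. Qed.

Lemma avgZ k f : continuous f -> avg (fun t => k * f t) = k * avg f.
Proof. by move=> cf; rewrite /avg RintegralZl//; exact: continuous_integrable_itv. Qed.

Lemma avg_cst k : avg (fun=> k) = k.
Proof.
rewrite /avg Rintegral_cst//= lebesgue_measure_itv/= lte_fin ltr01.
by rewrite oppr0 adde0/= mulr1.
Qed.

Lemma le_avg f g : continuous f -> continuous g -> (forall t, f t <= g t) ->
  avg f <= avg g.
Proof.
by move=> cf cg fg; apply: le_Rintegral => //; exact: continuous_integrable_itv.
Qed.

Lemma integral_EFin_avg f : continuous f ->
  (\int[mu]_(t in `[0%R, 1%R]) (f t)%:E = (avg f)%:E)%E.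
Proof.
move=> cf; rewrite /avg /Rintegral fineK//.
by apply: integrable_fin_num => //; exact: continuous_integrable_itv.
Qed.

Lemma eq_avg f g : f =1 g -> avg f = avg g.
Proof. by move=> fg; apply: eq_Rintegral => x _; exact: fg. Qed.

Lemma itv_FTC F f (a b : R) : a < b -> continuous f -> (forall t : R, is_derive t 1 F (f t)) ->
  \int[mu]_(t in `[a, b]) f t = F b - F a.
Proof.
move=> ab cf dF.
have cF : continuous F.
  by move=> x; apply: differentiable_continuous; apply/derivable1_diffP; exact: (@ex_derive _ _ _ _ _ _ _ (dF x)).
rewrite /Rintegral (@continuous_FTC2 _ f F)//.
- exact: continuous_subspaceT.
- split.
  + by move=> x _; exact: (@ex_derive _ _ _ _ _ _ _ (dF x)).
  + by apply: cvg_at_right_filter; exact: cF.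
  + by apply: cvg_at_left_filter; exact: cF.
- by move=> x _; rewrite derive1E; exact: (@derive_val _ _ _ _ _ _ _ (dF x)).
Qed.

Lemma Rintegral_shift f a b c : a <= b -> continuous f ->
  \int[mu]_(t in `[a + c, b + c]) f t = \int[mu]_(t in `[a, b]) f (t + c).
Proof.
move=> ab cf.
have dF (x : R) : is_derive x 1 (fun t : R => t + c) 1.
  by apply: is_derive_eq; rewrite addr0.
have F'E : derive1 (fun t : R => t + c) = cst 1.
  by apply/funext => x; rewrite derive1E (@derive_val _ _ _ _ _ _ _ (dF x)).
have cF : continuous (fun t : R => t + c).
  by move=> x; apply: cvgD; [exact: cvg_id|exact: cvg_cst].
rewrite /Rintegral (@integration_by_substitution_increasing R (fun t => t + c) f a b)//.
- congr fine; apply: eq_integral => x _ /=.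
  by rewrite F'E /= mulr1.
- by move=> x y _ _ xy; rewrite ltrD2r.
- by rewrite F'E => x _; exact: cst_continuous.
- by rewrite F'E; exact: is_cvg_cst.
- by rewrite F'E; exact: is_cvg_cst.
- split.
  + by move=> x _; exact: (@ex_derive _ _ _ _ _ _ _ (dF x)).
  + by apply: cvg_at_right_filter; exact: cF.
  + by apply: cvg_at_left_filter; exact: cF.
- exact: continuous_subspaceT.
Qed.

Lemma Rintegral_itv_cat f a b c : a <= b -> b <= c -> continuous f ->
  \int[mu]_(t in `[a, c]) f t =
  \int[mu]_(t in `[a, b]) f t + \int[mu]_(t in `[b, c]) f t.
Proof.
move=> ab bc cf.
have := @Rintegral_itvB R f (BLeft a) (BRight c) b (continuous_integrable_itv a c cf).
rewrite !bnd_simp => /(_ ab bc).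
rewrite -(@Rintegral_itv_obnd_cbnd _ b)//; last first.
  by apply: integrableS (continuous_integrable_itv b c cf) => //; exact: subset_itv_oc_cc.
by move=> <-; rewrite addrC subrK.
Qed.

(** Periodicity removes the integer part of [c]. For 0 <= c < 1 the interval [c, 1 + c] is cut at 1,
    and the piece beyond 1 is moved back to [0, c]. *)
Lemma avg_shift f c : continuous f -> (forall t, f (t + 1) = f t) ->
  avg (fun t => f (t + c)) = avg f.
Proof.
move=> cf pf.
have pint (n : int) t : f (t + n%:~R) = f t.
  have pnat (m : nat) u : f (u + m%:R) = f u.
    by elim: m u => [|m IH] u; rewrite ?addr0// -natr1 addrA pf IH.
  case: n => m; first exact: pnat.
  by rewrite NegzE -(pnat m.+1) rmorphN/= addrNK.
wlog c01 : c / 0 <= c < 1.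
  move=> H; rewrite -(H (c - (Num.floor c)%:~R)).
    by apply: eq_avg => t; rewrite addrA -[X in _ = f (_ + X)]rmorphN/= pint.
  have := Num.Theory.floor_le c; have := Num.Theory.floorD1_gt c => h1 h2.
  by apply/andP; split; move: h1 h2; rewrite intrD; lra.
case/andP: c01 => c0 /ltW c1.
rewrite /avg -Rintegral_shift ?ler01// add0r.
rewrite (Rintegral_itv_cat (b := 1))//; last by rewrite lerDl.
rewrite [in RHS](Rintegral_itv_cat (b := c))// addrC; congr +%R.
have := @Rintegral_shift f 0 c 1 c0 cf; rewrite add0r (addrC c) => ->.
by apply: eq_Rintegral => x _; exact: pf.
Qed.

End circle_average.

(** * Real powers: tangent inequality and continuity *)

Section real_powers.
Context {R : realType}.

(** Convexity of x^s, obtained from Young's inequality for y and x^(s-1) with conjugate exponents s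
    and s/(s-1); this route includes x = 0 and y = 0. *)
Lemma powR_ge_tangent (s x y : R) : 1 < s -> 0 <= x -> 0 <= y ->
  x `^ s + s * x `^ (s - 1) * (y - x) <= y `^ s.
Proof.
move=> s1 x0 y0; have s0 : 0 < s by lra.
have q0 : 0 < s / (s - 1) by rewrite divr_gt0//; lra.
have sq : s^-1 + (s / (s - 1))^-1 = 1 by field; lra.
have := @conjugate_powR R y (x `^ (s - 1)) s (s / (s - 1)) y0 (powR_ge0 _ _) s0 q0 sq.
rewrite -powRrM (_ : (s - 1) * (s / (s - 1)) = s); last by field; lra.
rewrite (_ : (s / (s - 1))^-1 = (s - 1) / s); last by field; lra.
move=> /(ler_wpM2l (ltW s0)).
rewrite (_ : s * (y `^ s / s + _) = y `^ s + (s - 1) * x `^ s); last by field; lra.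
rewrite mulrBr -[s * _ * x]mulrA [_ `^ (s - 1) * x]mulrC mulr_powRB1//.
lra.
Qed.

Lemma continuous_powR_pos (f : R -> R) s : (forall t, 0 < f t) ->
  continuous f -> continuous (fun t => f t `^ s).
Proof.
move=> f0 cf t; apply: (@continuous_comp R R R f (fun u : R => u `^ s)); first exact: cf.
apply: differentiable_continuous; apply/derivable1_diffP.
by apply: ex_derive; exact: is_derive1_powR.
Qed.

(** Where [f] is positive the power is differentiable. At a zero of [f], values of [f] below e^(1/s)
    have s-th power below e. *)
Lemma continuous_powR_ge0 (f : R -> R) s : 0 < s -> (forall t, 0 <= f t) ->
  continuous f -> continuous (fun t => f t `^ s).
Proof.
move=> s0 f0 cf t; have := f0 t; rewrite le_eqVlt => /predU1P[ft0|ftgt0]; last first.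
  apply: (@continuous_comp R R R f (fun u : R => u `^ s)); first exact: cf.
  apply: differentiable_continuous; apply/derivable1_diffP.
  by apply: ex_derive; exact: is_derive1_powR.
apply/cvgrPdist_lt => e e0; rewrite -ft0 powR0 ?gt_eqF//.
have e'0 : 0 < e `^ s^-1 by rewrite powR_gt0.
have /cvgrPdist_lt/(_ _ e'0) := cf t.
apply: filterS => u; rewrite -ft0 !sub0r !normrN !ger0_norm ?powR_ge0// => fu.
have -> : e = (e `^ s^-1) `^ s by rewrite -powRrM mulVf ?gt_eqF// powRr1// ltW.
by apply: gt0_ltr_powR => //; rewrite nnegrE ?powR_ge0// ltW.
Qed.

Lemma continuous_ln_pos (f : R -> R) : (forall t, 0 < f t) ->
  continuous f -> continuous (fun t => ln (f t)).
Proof.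
by move=> f0 cf t; apply: (@continuous_comp R R R f (@ln R)); [exact: cf|exact: continuous_ln].
Qed.

End real_powers.

(** * Jensen's formula *)

Section jensen.
Context {R : realType}.

Definition cosc (t : R) : R := cos (2 * pi * t).

Lemma coscD1 t : cosc (t + 1) = cosc t.
Proof.
rewrite /cosc (_ : 2 * pi * (t + 1) = 2 * pi * t + pi *+ 2); last by ring.
by rewrite cosD2pi.
Qed.

Lemma cosc_bound t : -1 <= cosc t <= 1.
Proof. by rewrite -ler_norml cos_max. Qed.

Lemma continuous_cosc : continuous cosc.
Proof.
move=> t; apply: (@continuous_comp _ _ _ (fun t => 2 * pi * t) (@cos R)); last exact: continuous_cos.
by apply: continuousM; [exact: cst_continuous|exact: cvg_id].
Qed.

Lemma continuous_lincosc (a b k : R) : continuous (fun t => a + b * cosc (k * t)).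
Proof.
move=> t; apply: cvgD; first exact: cvg_cst.
apply: cvgM; first exact: cvg_cst.
apply: (@continuous_comp _ _ _ (fun t => k * t) cosc); last exact: continuous_cosc.
by apply: continuousM; [exact: cst_continuous|exact: cvg_id].
Qed.

(** With e(t) = exp(2 pi i t), [f r m t] is |1 + r e(m t)|^2. *)
Let f (r : R) (m : nat) t := 1 + r ^+ 2 + 2 * r * cosc (m%:R * t).
Let A r m := avg (fun t => ln (f r m t)).

Let f_gt0 r m t : 0 <= r < 1 -> 0 < f r m t.
Proof.
move=> /andP[r0 r1]; rewrite /f; have := cosc_bound (m%:R * t).
set c := cosc _ => /andP[c1 c2].
have : 0 < (1 - r) ^+ 2 by rewrite exprn_gt0// subr_gt0.
have : 0 <= r * (c + 1) by rewrite mulr_ge0//; lra.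
nra.
Qed.

Let cf r m : 0 <= r < 1 -> continuous (fun t => ln (f r m t)).
Proof. by move=> r01; apply: continuous_ln_pos => [t|]; [exact: f_gt0|exact: continuous_lincosc]. Qed.

Lemma cosc_natD (m k : nat) t : cosc (m%:R * (t + k%:R)) = cosc (m%:R * t).
Proof.
rewrite mulrDr -natrM; elim: (m * k)%N => [|n IH]; first by rewrite addr0.
by rewrite -natr1 addrA coscD1.
Qed.

Lemma cosc_half (m : nat) t : (0 < m)%N -> cosc (m%:R * (t + (2 * m%:R)^-1)) = - cosc (m%:R * t).
Proof.
move=> m0; rewrite /cosc (_ : 2 * pi * _ = 2 * pi * (m%:R * t) + pi); first by rewrite cosDpi.
by field; rewrite pnatr_eq0 -lt0n.
Qed.

Let A_half r m : (0 < m)%N -> 0 <= r < 1 ->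
  A r m = avg (fun t => ln (1 + r ^+ 2 - 2 * r * cosc (m%:R * t))).
Proof.
move=> m0 r01; rewrite /A -(avg_shift (2 * m%:R)^-1)//.
- by apply: eq_avg => t; rewrite /f cosc_half// mulrN.
- exact: cf.
- by move=> t; rewrite /f (cosc_natD m 1).
Qed.

Lemma sqr_lt1 (r : R) : 0 <= r < 1 -> 0 <= r ^+ 2 < 1.
Proof. by move=> /andP[r0 r1]; rewrite sqr_ge0/= exprn_ilt1. Qed.

(* |1 + r e(t)| |1 - r e(t)| = |1 - r^2 e(2t)| *)
Let A_double r m : (0 < m)%N -> 0 <= r < 1 -> 2 * A r m = A (r ^+ 2) (2 * m).
Proof.
move=> m0 r01; rewrite (_ : 2 * A r m = A r m + A r m); last by ring.
have gt0 t : 0 < 1 + r ^+ 2 - 2 * r * cosc (m%:R * t).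
  by rewrite -mulrN -cosc_half//; exact: (f_gt0 m _ r01).
rewrite [X in _ + X]A_half// [RHS]A_half ?muln_gt0//; last exact: sqr_lt1.
rewrite {1}/A -avgD; last 2 first.
- exact: cf.
- apply: continuous_ln_pos => //; under eq_fun do rewrite -mulNr.
  exact: continuous_lincosc.
apply: eq_avg => t; rewrite -lnM ?posrE//; last exact: f_gt0.
congr ln; rewrite /f natrM.
have -> : cosc (2%:R * m%:R * t) = 2 * cosc (m%:R * t) ^+ 2 - 1.
  rewrite /cosc (_ : 2 * pi * _ = (2 * pi * (m%:R * t)) *+ 2); last by ring.
  by rewrite cos_mulr2n; ring.
by ring.
Qed.

(** Uniform in [r] and [m], so that it survives the iteration of [A_double]; it comes from ln(1 + x)
    <= x. *)
Let A_le3 r m : 0 <= r < 1 -> A r m <= 3.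
Proof.
move=> r01; rewrite -(avg_cst 3); apply: le_avg => [|x|t]; [exact: cf|exact: cst_continuous|].
have /andP[r0 r1] := r01; have := f_gt0 m t r01.
rewrite /f; have := cosc_bound (m%:R * t).
set c := cosc _ => /andP[c1 c2] h.
have := @le_ln1Dx R (r ^+ 2 + 2 * r * c); rewrite addrA => H.
apply: (le_trans (H _)); first by lra.
have : r * c <= 1 by apply: (le_trans (y := r * 1)); [apply: ler_wpM2l => //|lra].
have : r ^+ 2 <= 1 by rewrite expr_le1// ltW.
lra.
Qed.

(** The upper half of Jensen's formula. Iterating [A_double] gives 2^k A(r, 1) = A(r^(2^k), 2^k) <=
    3 for every k, which forces A(r, 1) <= 0. *)
Lemma avg_ln_le0 (r : R) : 0 <= r < 1 ->
  avg (fun t => ln (1 + r ^+ 2 + 2 * r * cosc t)) <= 0.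
Proof.
move=> r01.
have iter k : 2 ^+ k * A r 1 <= 3.
  suff : exists2 r', 0 <= r' < 1 & 2 ^+ k * A r 1 = A r' (2 ^ k).
    by move=> [r' ? ->]; exact: A_le3.
  elim: k => [|k [r' r'01 IH]]; first by exists r => //; rewrite mul1r.
  exists (r' ^+ 2); first exact: sqr_lt1.
  by rewrite exprS -mulrA IH A_double ?expn_gt0// -expnS.
have -> : avg (fun t => ln (1 + r ^+ 2 + 2 * r * cosc t)) = A r 1.
  by apply: eq_avg => t; rewrite /f mul1r.
rewrite leNgt; apply/negP => A0.
have := archi_boundP (ltW (divr_gt0 (ltr0Sn R 2) A0)).
set k := Num.bound _ => hk.
have := iter k; apply/negP; rewrite -ltNge -ltr_pdivrMr//.
apply: (lt_trans hk); rewrite -natrX ltr_nat; exact: ltn_expl.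
Qed.

End jensen.

(** * Calculus *)

Section calculus.
Context {R : realType}.
Implicit Types f g : R -> R.

Lemma is_derive_funM f g (x a b : R) : is_derive x 1 f a -> is_derive x 1 g b ->
  is_derive x 1 (fun t => f t * g t) (a * g x + f x * b).
Proof.
move=> fa gb; have -> : a * g x + f x * b = f x *: b + g x *: a.
  by rewrite addrC [a * _]mulrC.
exact: is_deriveM.
Qed.

Lemma is_derive_funD f g (x a b : R) : is_derive x 1 f a -> is_derive x 1 g b ->
  is_derive x 1 (fun t => f t + g t) (a + b).
Proof. by move=> fa gb; exact: is_deriveD. Qed.

Lemma is_derive_funB f g (x a b : R) : is_derive x 1 f a -> is_derive x 1 g b ->
  is_derive x 1 (fun t => f t - g t) (a - b).
Proof. by move=> fa gb; exact: is_deriveB. Qed.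

Lemma is_derive_funZ k f (x a : R) : is_derive x 1 f a ->
  is_derive x 1 (fun t => k * f t) (k * a).
Proof. by move=> fa; exact: is_deriveZ. Qed.

Lemma is_derive_fun_comp f g (x a b : R) : is_derive (g x) 1 f a ->
  is_derive x 1 g b -> is_derive x 1 (fun t => f (g t)) (a * b).
Proof. by move=> fa gb; exact: is_derive1_comp. Qed.

Lemma is_derive_scal k (x : R) : is_derive x 1 (fun t : R => k * t) k.
Proof. by rewrite -[X in is_derive _ _ _ X]mulr1; apply: is_derive_funZ; exact: is_derive_id. Qed.

Lemma is_derive_continuous f (x a : R) : is_derive x 1 f a -> {for x, continuous f}.
Proof.
by move=> fa; apply: differentiable_continuous; apply/derivable1_diffP; exact: (@ex_derive _ _ _ _ _ _ _ fa).
Qed.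

Lemma is_derive_within_continuous f (df : R -> R) (a b : R) :
  (forall z, a <= z <= b -> is_derive z 1 f (df z)) -> {within `[a, b], continuous f}.
Proof.
move=> fdf; apply: continuous_in_subspaceT => z; rewrite inE/= in_itv/= => zab.
exact: is_derive_continuous (fdf _ zab).
Qed.

Lemma is_derive_lt f (df : R -> R) (a b : R) : a < b ->
  (forall z, a <= z <= b -> is_derive z 1 f (df z)) ->
  (forall z, a < z < b -> 0 < df z) -> f a < f b.
Proof.
move=> ab fdf df0.
have fd z : z \in `]a, b[ -> is_derive z 1 f (df z).
  by rewrite in_itv/= => /andP[/ltW az /ltW zb]; apply: fdf; rewrite az.
have [c cab E] := MVT ab fd (is_derive_within_continuous fdf).
by rewrite -subr_gt0 E mulr_gt0 ?subr_gt0// df0//; move: cab; rewrite in_itv.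
Qed.

(** First and second derivative tests for f' = k g with k > 0. At a critical point f'' has the sign
    of g', so only [g] has to be differentiated. *)
Lemma interior_max_derive f k g (a b x d : R) : a < x < b ->
  (forall z, a < z < b -> 0 < k z) ->
  (forall z, a < z < b -> is_derive z 1 f (k z * g z)) ->
  is_derive x 1 g d -> (forall z, a < z < b -> f z <= f x) ->
  g x = 0 /\ d <= 0.
Proof.
move=> /[dup] xab /andP[ax xb] k0 fd gd fmax.
have gx0 : g x = 0.
  have [_ fx'] := fd _ xab.
  have := @derive1_at_max R f a b x _ _ _ _.
  move=> H; have /H[] : a <= b by lra.
  - by move=> z; rewrite in_itv/= => zab; exact: (@ex_derive _ _ _ _ _ _ _ (fd _ zab)).
  - by rewrite in_itv.
  - by move=> z; rewrite in_itv/= => zab; exact: fmax.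
  move=> _ /esym; rewrite fx' => /eqP; rewrite eq_sym mulf_eq0 gt_eqF ?k0//=.
  by move=> /eqP.
split=> //; rewrite leNgt; apply/negP => d0.
(* If d > 0, the slope function [c] of [g] is positive near x, hence g > 0 just to the right of x
   and [f] increases there, contradicting maximality. *)
have [c [gc cc cx]] := (is_derive1_caratheodory g x d).1 gd.
have : \forall z \near x, 0 < c z.
  by apply: (cvgr_gt _ cc); rewrite cx.
move=> /nbhs_ballP[e /= e0 ec].
set y := Num.min (x + e / 2) ((x + b) / 2).
have xy : x < y by rewrite lt_min; apply/andP; split; lra.
have ye : y <= x + e / 2 by rewrite ge_min lexx.
have yb : y < b by rewrite gt_min; apply/orP; right; lra.
suff : f x < f y by apply/negP; rewrite -leNgt fmax//; apply/andP; split; lra.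
apply: (is_derive_lt xy (df := fun z => k z * g z)) => z /andP[z1 z2].
  by apply: fd; apply/andP; split; lra.
rewrite mulr_gt0 ?k0//; first by apply/andP; split; lra.
have := gc z; rewrite gx0 subr0 => ->; rewrite mulr_gt0 ?subr_gt0//.
by apply: ec; rewrite /ball/= ltr_distlC; apply/andP; split; lra.
Qed.

End calculus.

(** * Hyperbolic functions *)

Section hyperbolic.
Context {R : realType}.
Implicit Types t : R.

Definition ch t : R := (expR t + expR (- t)) / 2.
Definition sh t : R := (expR t - expR (- t)) / 2.

Lemma is_derive_expRN t : is_derive t 1 (fun u : R => expR (- u)) (- expR (- t)).
Proof.
rewrite -mulrN1; apply: is_derive_fun_comp.
Qed.

Lemma is_derive_ch t : is_derive t 1 ch (sh t).
Proof.
rewrite /ch /sh; under eq_fun do rewrite mulrC.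
rewrite mulrC; apply: is_derive_funZ; apply: is_derive_funD; exact: is_derive_expRN.
Qed.

Lemma is_derive_sh t : is_derive t 1 sh (ch t).
Proof.
rewrite /ch /sh; under eq_fun do rewrite mulrC.
rewrite mulrC; apply: is_derive_funZ; rewrite -[X in _ + X]opprK.
by apply: is_derive_funB; exact: is_derive_expRN.
Qed.

Lemma is_derive_chM a t : is_derive t 1 (fun u => ch (a * u)) (sh (a * t) * a).
Proof. by apply: is_derive_fun_comp; [exact: is_derive_ch|exact: is_derive_scal]. Qed.

Lemma is_derive_shM a t : is_derive t 1 (fun u => sh (a * u)) (ch (a * t) * a).
Proof. by apply: is_derive_fun_comp; [exact: is_derive_sh|exact: is_derive_scal]. Qed.

Lemma ch0 : ch 0 = 1. Proof. by rewrite /ch oppr0 expR0; lra. Qed.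
Lemma sh0 : sh 0 = 0. Proof. by rewrite /sh oppr0 subrr mul0r. Qed.

Lemma ch_gt0 t : 0 < ch t.
Proof. by rewrite /ch divr_gt0// addr_gt0// expR_gt0. Qed.

Lemma sh_gt0 t : 0 < t -> 0 < sh t.
Proof. by move=> t0; rewrite /sh divr_gt0// subr_gt0 ltr_expR; lra. Qed.

Lemma chsh t : ch t ^+ 2 - sh t ^+ 2 = 1.
Proof.
rewrite /ch /sh; have := expRxMexpNx_1 t.
set x := expR t; set y := expR (- t) => xy.
by rewrite (_ : _ - _ = x * y); [|field].
Qed.

Lemma ch_gt1 t : 0 < t -> 1 < ch t.
Proof.
move=> t0; rewrite -ch0; apply: (is_derive_lt t0 (df := sh)) => [z _|z /andP[z0 _]].
  exact: is_derive_ch.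
exact: sh_gt0.
Qed.

(** The quotient sh(a u) / sh u decreases. Up to a negative factor its derivative is sh(a u) ch u -
    a ch(a u) sh u, which vanishes at 0 and has derivative (1 - a^2) sh(a u) sh u > 0. *)
Lemma sh_ratio_decr (a x y : R) : 0 < a < 1 -> 0 < x -> x < y ->
  sh (a * y) * sh x < sh (a * x) * sh y.
Proof.
move=> /andP[a0 a1] x0 xy.
have om z : 0 < z -> a * ch (a * z) * sh z < sh (a * z) * ch z.
  move=> z0; rewrite -subr_gt0.
  pose f u := sh (a * u) * ch u - a * (ch (a * u) * sh u).
  have -> : sh (a * z) * ch z - a * ch (a * z) * sh z = f z by rewrite /f; ring.
  have f0 : f 0 = 0 by rewrite /f mulr0 sh0 mul0r mulr0 mulr0 subr0.
  rewrite -f0.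
  apply: (is_derive_lt z0 (df := fun u =>
     (ch (a * u) * a * ch u + sh (a * u) * sh u) -
     a * (sh (a * u) * a * sh u + ch (a * u) * ch u))).
    move=> u _; apply: is_derive_funB.
      by apply: is_derive_funM; [exact: is_derive_shM|exact: is_derive_ch].
    by apply: is_derive_funZ; apply: is_derive_funM; [exact: is_derive_chM|exact: is_derive_sh].
  move=> u /andP[u0 _].
  rewrite (_ : _ - _ = (1 - a ^+ 2) * (sh (a * u) * sh u)); last by ring.
  by apply: mulr_gt0; [nra|rewrite mulr_gt0 ?sh_gt0 ?mulr_gt0].
suff : - (sh (a * x) / sh x) < - (sh (a * y) / sh y).
  rewrite ltrN2 ltr_pdivrMr ?sh_gt0//; last by lra.
  by rewrite mulrAC ltr_pdivlMr ?sh_gt0.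
have shV (u : R) : 0 < u -> is_derive u 1 (fun u => (sh u)^-1) (- (sh u) ^- 2 * ch u).
  move=> u0; apply: is_derive_eq; first exact: (is_deriveV (lt0r_neq0 (sh_gt0 u0)) (is_derive_sh u)).
  by [].
apply: (is_derive_lt xy (f := fun u => - (sh (a * u) / sh u)) (df := fun u => -1 *
   (ch (a * u) * a * (sh u)^-1 + sh (a * u) * (- (sh u) ^- 2 * ch u)))).
  move=> u /andP[xu _]; under eq_fun do rewrite -mulN1r.
  apply: is_derive_funZ; apply: is_derive_funM; first exact: is_derive_shM.
  by apply: shV; lra.
move=> u /andP[xu _].
have u0 : 0 < u by lra.
have s0 := sh_gt0 u0.
rewrite [X in 0 < X](_ : _ = (sh (a * u) * ch u - a * ch (a * u) * sh u) / sh u ^+ 2).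
  by rewrite divr_gt0 ?exprn_gt0// subr_gt0 om.
by field; rewrite gt_eqF.
Qed.

End hyperbolic.

(** * Legendre functions *)

Section legendre.
Context {R : realType}.
Implicit Types s h : R.

Definition sinc (t : R) : R := sin (2 * pi * t).

Lemma is_derive_cosc (t : R) : is_derive t 1 (@cosc R) (- sinc t * (2 * pi)).
Proof. by apply: is_derive_fun_comp; exact: is_derive_scal. Qed.

Lemma is_derive_sinc (t : R) : is_derive t 1 sinc (cosc t * (2 * pi)).
Proof. by apply: is_derive_fun_comp; exact: is_derive_scal. Qed.

Lemma cos2Dsin2c t : cosc t ^+ 2 + sinc t ^+ 2 = 1.
Proof. exact: cos2Dsin2. Qed.

Lemma sinc0 : sinc 0 = 0. Proof. by rewrite /sinc mulr0 sin0. Qed.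
Lemma sinc1 : sinc 1 = 0.
Proof. by rewrite /sinc mulr1 (_ : 2 * pi = pi *+ 2) ?sin2pi// mulr_natl. Qed.

Lemma avg_derive (F f : R -> R) : continuous f -> (forall t : R, is_derive t 1 F (f t)) ->
  avg f = F 1 - F 0.
Proof. by move=> cf dF; rewrite /avg (itv_FTC _ cf dF). Qed.

Lemma avg_cosc : avg (@cosc R) = 0.
Proof.
have := @avg_derive sinc (fun t => 2 * pi * cosc t).
rewrite avgZ; last exact: continuous_cosc.
rewrite sinc0 sinc1 subrr => H.
have /eqP : 2 * pi * avg (@cosc R) = 0.
  apply: H.
    by move=> t; apply: cvgM; [exact: cvg_cst|exact: continuous_cosc].
  by move=> t; rewrite mulrC; exact: is_derive_sinc.
by rewrite mulf_eq0 gt_eqF ?mulr_gt0 ?pi_gt0// => /eqP.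
Qed.

(** For h > 1 this is Laplace's integral for the Legendre function P_s, rescaled: N_s(h) = (h^2 -
    1)^(s/2) P_s(h / sqrt(h^2 - 1)). *)
Definition legN s h : R := avg (fun t => (h + cosc t) `^ s).

Lemma continuous_addcosc h : continuous (fun t => h + cosc t).
Proof. by move=> t; apply: cvgD; [exact: cvg_cst|exact: continuous_cosc]. Qed.

Lemma addcosc_gt0 h t : 1 < h -> 0 < h + cosc t.
Proof. by move=> h1; have /andP[] := cosc_bound t; lra. Qed.

Lemma addcosc_ge0 h t : 1 <= h -> 0 <= h + cosc t.
Proof. by move=> h1; have /andP[] := cosc_bound t; lra. Qed.

Lemma continuous_addcosc_powR s h : 1 < h -> continuous (fun t => (h + cosc t) `^ s).
Proof.
move=> h1; apply: continuous_powR_pos; last exact: continuous_addcosc.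
by move=> t; exact: addcosc_gt0.
Qed.

Lemma continuous_addcosc_powR_ge s h : 0 < s -> 1 <= h -> continuous (fun t => (h + cosc t) `^ s).
Proof.
move=> s0 h1; apply: continuous_powR_ge0 => //; last exact: continuous_addcosc.
by move=> t; exact: addcosc_ge0.
Qed.

(** The sign of the exponent is left open because s - 1 and s - 2 occur as exponents. A power is
    monotone either way, and the sum of the endpoint values bounds it in both cases. *)
Lemma powR_itv_bound s (lo hi x : R) : 0 < lo -> lo <= x <= hi ->
  Num.min (lo `^ s) (hi `^ s) <= x `^ s <= lo `^ s + hi `^ s.
Proof.
move=> lo0 /andP[lox xhi].
have x0 : 0 < x by lra.
have hi0 : 0 < hi by lra.
have [s0|s0] := leP 0 s.
  have := ge0_ler_powR s0 (ltW lo0) (ltW x0) lox.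
  have := ge0_ler_powR s0 (ltW x0) (ltW hi0) xhi.
  have := powR_ge0 lo s => l0 h1 h2.
  by rewrite ge_min h2/=; lra.
have mono u v : 0 < u -> u <= v -> v `^ s <= u `^ s.
  move=> u0 uv; have v0 : 0 < v by lra.
  rewrite -[s]opprK !(powRN _ (- s)) lef_pV2 ?posrE ?powR_gt0//.
  by apply: ge0_ler_powR => //; rewrite ?nnegrE; lra.
have := mono _ _ lo0 lox; have := mono _ _ x0 xhi; have := powR_ge0 hi s.
by move=> h0 h1 h2; rewrite ge_min h1 orbT/=; lra.
Qed.

Lemma legN_gt0 s h : 1 < h -> 0 < legN s h.
Proof.
move=> h1; have lo0 : 0 < h - 1 by lra.
apply: (@lt_le_trans _ _ (Num.min ((h - 1) `^ s) ((h + 1) `^ s))).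
  by rewrite lt_min !powR_gt0//; lra.
rewrite -[leLHS]avg_cst; apply: le_avg => [x||t]; first exact: cvg_cst.
- exact: continuous_addcosc_powR.
- have /andP[c1 c2] := cosc_bound t.
  have /(powR_itv_bound s lo0)/andP[//] : h - 1 <= h + cosc t <= h + 1.
  by apply/andP; split; lra.
Qed.

(** Average of the tangent to x^s at x = 1; the cosine has mean 0. *)
Lemma legN_ge s h : 1 < s -> 1 <= h -> 1 + s * (h - 1) <= legN s h.
Proof.
move=> s1 h1.
have -> : 1 + s * (h - 1) = avg (fun t => 1 + s * (h - 1) + s * cosc t).
  rewrite (avgD (f := fun=> 1 + s * (h - 1)) (g := fun t => s * cosc t)).
  - by rewrite avg_cst avgZ ?avg_cosc ?mulr0 ?addr0//; exact: continuous_cosc.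
  - by move=> t; exact: cvg_cst.
  - by move=> t; apply: cvgM; [exact: cvg_cst|exact: continuous_cosc].
apply: le_avg.
- move=> t; apply: cvgD; first exact: cvg_cst.
  by apply: cvgM; [exact: cvg_cst|exact: continuous_cosc].
- by apply: continuous_addcosc_powR_ge => //; lra.
- move=> t; have := powR_ge_tangent s1 ler01 (addcosc_ge0 t h1).
  by rewrite !powR1; apply: le_trans; lra.
Qed.

(** Controls the endpoint h = 1, which the derivative formula does not reach. The lower bound is
    monotonicity; the upper one is the tangent at h + cos evaluated at 1 + cos. *)
Lemma legN_lipschitz s h : 1 < s -> 1 <= h ->
  legN s 1 <= legN s h <= legN s 1 + s * (h + 1) `^ (s - 1) * (h - 1).
Proof.
move=> s1 h1; have s0 : 0 < s by lra.
apply/andP; split.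
  apply: le_avg; [exact: continuous_addcosc_powR_ge|exact: continuous_addcosc_powR_ge|].
  by move=> t; apply: ge0_ler_powR; rewrite ?nnegrE ?addcosc_ge0 ?lerD2r//; exact: ltW.
rewrite -[X in _ + X]avg_cst -avgD; last 2 first.
  exact: continuous_addcosc_powR_ge.
  by move=> t; exact: cvg_cst.
apply: le_avg; first exact: continuous_addcosc_powR_ge.
  by move=> t; apply: cvgD; [exact: continuous_addcosc_powR_ge|exact: cvg_cst].
move=> t; have := powR_ge_tangent s1 (addcosc_ge0 t h1) (addcosc_ge0 t (lexx 1)).
rewrite (_ : 1 + cosc t - (h + cosc t) = - (h - 1)); last by ring.
have : s * (h + cosc t) `^ (s - 1) * (h - 1) <= s * (h + 1) `^ (s - 1) * (h - 1).
  rewrite ler_wpM2r//; first lra.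
  rewrite ler_wpM2l//; first exact: ltW.
  have /andP[c1 c2] := cosc_bound t.
  apply: ge0_ler_powR; rewrite ?nnegrE ?addcosc_ge0//; lra.
by rewrite mulrN; lra.
Qed.

(* The three-term recurrence of Legendre functions: integrate the derivative of
   sin (h + cos)^(s-1) over the circle. *)
Lemma legN_rec s h : 1 < h ->
  s * legN s h - (2 * s - 1) * h * legN (s - 1) h
    + (s - 1) * (h ^+ 2 - 1) * legN (s - 2) h = 0.
Proof.
move=> h1.
pose F t := sinc t * (h + cosc t) `^ (s - 1).
pose f t := s * (h + cosc t) `^ s + (- ((2 * s - 1) * h) * (h + cosc t) `^ (s - 1)
    + (s - 1) * (h ^+ 2 - 1) * (h + cosc t) `^ (s - 2)).
have cp k r : continuous (fun t => k * (h + cosc t) `^ r).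
  by move=> t; apply: cvgM; [exact: cvg_cst|exact: continuous_addcosc_powR].
have cf : continuous f.
  by move=> t; apply: cvgD; [exact: cp|apply: cvgD; exact: cp].
have dF (t : R) : is_derive t 1 F (2 * pi * f t).
  have u0 := addcosc_gt0 t h1.
  have du : is_derive t 1 (fun t => (h + cosc t) `^ (s - 1))
      ((s - 1) * (h + cosc t) `^ (s - 1 - 1) * (0 + - sinc t * (2 * pi))).
    apply: (is_derive_fun_comp (f := fun u => u `^ (s - 1)) (g := fun t => h + cosc t)).
      exact: is_derive1_powR.
    by apply: is_derive_funD; exact: is_derive_cosc.
  suff -> : 2 * pi * f t = cosc t * (2 * pi) * (h + cosc t) `^ (s - 1) + sinc t *
      ((s - 1) * (h + cosc t) `^ (s - 1 - 1) * (0 + - sinc t * (2 * pi))).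
    exact: is_derive_funM (is_derive_sinc t) du.
  rewrite /f (_ : s - 1 - 1 = s - 2); last by ring.
  (* Once all powers are multiples of (h + cos)^(s-2) and sin^2 is replaced by 1 - cos^2, the
     identity is polynomial in cos. *)
  have e1 : (h + cosc t) `^ (s - 1) = (h + cosc t) * (h + cosc t) `^ (s - 2).
    by rewrite -{2}[h + cosc t]powRr1 ?ltW// -powRD ?(gt_eqF u0) ?implybT//; congr powR; ring.
  have e0 : (h + cosc t) `^ s = (h + cosc t) ^+ 2 * (h + cosc t) `^ (s - 2).
    by rewrite -powR_mulrn ?ltW// -powRD ?(gt_eqF u0) ?implybT//; congr powR; ring.
  rewrite e0 e1; have := cos2Dsin2c t.
  set c := cosc t; set d := sinc t; set w := powR _ _ => cd.
  have -> : d * ((s - 1) * w * (0 + - d * (2 * pi))) = - (s - 1) * w * (2 * pi) * d ^+ 2 by ring.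
  by rewrite (_ : d ^+ 2 = 1 - c ^+ 2); [ring|rewrite -cd; ring].
have := avg_derive _ dF.
rewrite /F sinc0 sinc1 !mul0r subrr avgZ// => H.
have {H}/eqP : 2 * pi * avg f = 0.
  by apply: H => t; apply: cvgM; [exact: cvg_cst|exact: cf].
rewrite mulf_eq0 gt_eqF ?mulr_gt0 ?pi_gt0//= => /eqP <-.
rewrite /f avgD; [|exact: cp|by move=> t; apply: cvgD; exact: cp].
rewrite avgD; [|exact: cp|exact: cp].
rewrite !avgZ; [|exact: continuous_addcosc_powR..].
rewrite -/(legN s h) -/(legN (s - 1) h) -/(legN (s - 2) h).
by move: (legN s h) (legN (s - 1) h) (legN (s - 2) h) => x y z; ring.
Qed.

Lemma is_derive_legN s h : 1 < h -> is_derive h 1 (legN s) (s * legN (s - 1) h).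
Proof.
move=> h1.
pose f x t := (x + cosc t : R) `^ s.
have df (x t : R) : 1 < x -> is_derive x 1 (f ^~ t) (s * (x + cosc t) `^ (s - 1)).
  move=> x1; rewrite -[X in is_derive _ _ _ X]mulr1.
  apply: (is_derive_fun_comp (f := fun u => u `^ s) (g := fun x => x + cosc t)).
    by apply: is_derive1_powR; exact: addcosc_gt0.
  by rewrite -[X in is_derive _ _ _ X]addr0; exact: is_derive_funD.
have pE x t : 1 < x -> partial1of2 f x t = s * (x + cosc t) `^ (s - 1).
  by move=> x1; rewrite partial1of2E; exact: (@derive_val _ _ _ _ _ _ _ (df x t x1)).
(* For x in ](1 + h)/2, h + 1[ the sum x + cos stays in [lo, hi], away from 0, so the constant [G]
   dominates the derivative of the integrand. *)
pose lo := (h - 1) / 2; pose hi := h + 2.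
have lo0 : 0 < lo by rewrite /lo; lra.
pose G := `|s| * (lo `^ (s - 1) + hi `^ (s - 1)).
have Ih : [set` `](1 + h) / 2, h + 1[] h by rewrite /= in_itv/=; lra.
have I1 x : [set` `](1 + h) / 2, h + 1[] x -> 1 < x by rewrite /= in_itv/= => /andP[? _]; lra.
have m01 : measurable (`[0, 1] : set R) by exact: measurable_itv.
have intf x : [set` `](1 + h) / 2, h + 1[] x ->
    (@lebesgue_measure R).-integrable `[0, 1] (EFin \o f x).
  by move=> /I1 x1; apply: continuous_integrable_itv; exact: continuous_addcosc_powR.
have derf x t : [set` `](1 + h) / 2, h + 1[] x -> (`[0, 1]%classic : set R) t -> derivable (f ^~ t) x 1.
  by move=> /I1 x1 _; exact: (@ex_derive _ _ _ _ _ _ _ (df x t x1)).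
have G0 (t : R) : 0 <= G by rewrite mulr_ge0// addr_ge0// powR_ge0.
have intG : (@lebesgue_measure R).-integrable `[0, 1] (EFin \o (fun=> G)).
  by apply: continuous_integrable_itv => x; exact: cvg_cst.
have Gub x t : [set` `](1 + h) / 2, h + 1[] x -> (`[0, 1]%classic : set R) t -> `|partial1of2 f x t| <= G.
  move=> /[dup] /I1 x1; rewrite /= in_itv/= => /andP[xl xh] _.
  rewrite pE// normrM ler_wpM2l//  ger0_norm ?powR_ge0//.
  have /andP[c1 c2] := cosc_bound t.
  suff : lo <= x + cosc t <= hi by move=> /(powR_itv_bound (s - 1) lo0)/andP[].
  by move: h1 xl xh c1 c2; rewrite /lo /hi; clear; lra.
have E := @differentiation_under_integral R _ _ lebesgue_measure f `[0, 1] m01 h ((1 + h) / 2) (h + 1) Ih intf derf (fun=> G) G0 intG Gub.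
have D := @derivable_under_integral R _ _ lebesgue_measure f `[0, 1] m01 h ((1 + h) / 2) (h + 1) Ih intf derf (fun=> G) G0 intG Gub.
split; first exact: D.
rewrite -derive1E [LHS]E -avgZ; last exact: continuous_addcosc_powR.
by apply: eq_avg => t; rewrite pE.
Qed.

(** The letters [A], [A1], [A2] stand for N_s, N_(s-1), N_(s-2) at h = 1 + e, and [B], [B1] for N_s,
    N_(s-1) at 1. Replacing the former by the latter in the recurrence costs O(e), and the factor
    h^2 - 1 makes the last term O(e) too. *)
Lemma legN1_rec_approx (s e h A A1 A2 B B1 k1 k2 k3 : R) : 2 < s -> 0 < e -> e < 1 -> h = 1 + e ->
  0 <= B1 -> 0 <= A2 -> A2 <= k3 ->
  B <= A <= B + s * k1 * e -> B1 <= A1 <= B1 + (s - 1) * k2 * e ->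
  s * A - (2 * s - 1) * h * A1 + (s - 1) * (h ^+ 2 - 1) * A2 = 0 ->
  `|s * B - (2 * s - 1) * B1| <=
    (s * (s * k1) + (2 * s - 1) * ((s - 1) * k2) * 2 + (2 * s - 1) * B1 + (s - 1) * 3 * k3) * e.
Proof.
move=> s2 e0 e1 -> B10 A20 A2k /andP[a1 a2] /andP[b1 b2] rec.
have -> : s * B - (2 * s - 1) * B1 = - (s * (A - B))
    + (2 * s - 1) * ((1 + e) * (A1 - B1) + e * B1) - (s - 1) * e * ((2 + e) * A2).
  transitivity (s * B - (2 * s - 1) * B1 -
    (s * A - (2 * s - 1) * (1 + e) * A1 + (s - 1) * ((1 + e) ^+ 2 - 1) * A2)).
    by rewrite rec subr0.
  by ring.
have t1 : 0 <= s * (A - B) <= s * (s * k1) * e.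
  rewrite mulr_ge0 ?subr_ge0//=; last lra.
  by rewrite -mulrA ler_wpM2l ?lerBlDl//; lra.
have t2 : 0 <= (1 + e) * (A1 - B1) <= 2 * ((s - 1) * k2 * e).
  rewrite mulr_ge0 ?subr_ge0//=; last lra.
  by apply: ler_pM; rewrite ?subr_ge0 ?lerBlDl//; lra.
have t3 : 0 <= (2 + e) * A2 <= 3 * k3.
  by rewrite mulr_ge0//=; [apply: ler_pM|]; lra.
have t4 : 0 <= (s - 1) * e * ((2 + e) * A2) <= (s - 1) * e * (3 * k3).
  have ? : 0 <= (s - 1) * e by rewrite mulr_ge0 ?subr_ge0//; lra.
  by case/andP: t3 => ? ?; rewrite mulr_ge0 ?ler_wpM2l.
have t5 : 0 <= (2 * s - 1) * ((1 + e) * (A1 - B1) + e * B1) <=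
    (2 * s - 1) * (2 * ((s - 1) * k2 * e) + e * B1).
  have ? : 0 <= e * B1 by rewrite mulr_ge0// ltW.
  have ? : 0 <= 2 * s - 1 by lra.
  case/andP: t2 => ? ?; apply/andP; split; first exact/mulr_ge0/addr_ge0.
  by apply: ler_wpM2l; rewrite ?lerD2r.
have -> : (s * (s * k1) + (2 * s - 1) * ((s - 1) * k2) * 2 + (2 * s - 1) * B1 + (s - 1) * 3 * k3) * e
  = s * (s * k1) * e + (2 * s - 1) * (2 * ((s - 1) * k2 * e) + e * B1) +
    (s - 1) * e * (3 * k3) by ring.
have key (a b c qa qb qc : R) : 0 <= a <= qa -> 0 <= b <= qb -> 0 <= c <= qc ->
  `|- a + b - c| <= qa + qb + qc by rewrite ler_norml; lra.
exact: key.
Qed.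

(* The limit h -> 1 of legN_rec; for 2 < s the term in N_(s-2) disappears. *)
Lemma legN1_rec s : 2 < s -> s * legN s 1 = (2 * s - 1) * legN (s - 1) 1.
Proof.
move=> s2; have [s1 s11] : 1 < s /\ 1 < s - 1 by lra.
have [s10 [s20 s110]] : 0 <= s - 1 /\ 0 <= s - 2 /\ 0 <= s - 1 - 1 by lra.
have [s0 s21] : 0 <= s /\ 0 <= 2 * s - 1 by lra.
have N10 : 0 <= legN (s - 1) 1.
  by apply: le_trans (legN_ge s11 (lexx _)); rewrite subrr mulr0 addr0.
set X := s * legN s 1 - (2 * s - 1) * legN (s - 1) 1.
suff : X = 0 by move=> /eqP; rewrite subr_eq0 => /eqP.
pose C := s * (s * 3 `^ (s - 1)) + (2 * s - 1) * ((s - 1) * 3 `^ (s - 1 - 1)) * 2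
   + (2 * s - 1) * legN (s - 1) 1 + (s - 1) * 3 * 3 `^ (s - 2).
have C0 : 0 <= C by rewrite /C; do ![exact: powR_ge0 | done | apply: addr_ge0 | apply: mulr_ge0].
have XC e : 0 < e -> e < 1 -> `|X| <= C * e.
  move=> e0 e1; have [h [hE h1 h10 h13]] : exists h, [/\ h = 1 + e, 1 < h, 0 <= h + 1 & h + 1 <= 3].
    by exists (1 + e); split=> //; lra.
  have n2 : legN (s - 2) h <= 3 `^ (s - 2).
    rewrite -[leRHS]avg_cst; apply: le_avg => [|x|t]; [exact: continuous_addcosc_powR|exact: cvg_cst|].
    have /andP[c1 c2] := cosc_bound t.
    have t0 := addcosc_gt0 t h1.
    have t3 : h + cosc t <= 3 by lra.
    by apply: ge0_ler_powR => //; rewrite nnegrE; exact: ltW.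
  have p1 := ge0_ler_powR s10 h10 (ler0n _ 3) h13.
  have p2 := ge0_ler_powR s110 h10 (ler0n _ 3) h13.
  have /andP[a1 a2] := legN_lipschitz s1 (ltW h1).
  have /andP[b1 b2] := legN_lipschitz s11 (ltW h1).
  have hE1 : h - 1 = e by rewrite hE addrC addKr.
  have a2' : legN s h <= legN s 1 + s * 3 `^ (s - 1) * e.
    by apply: (le_trans a2); rewrite lerD2l hE1; apply: ler_wpM2r; [exact: ltW|exact: ler_wpM2l].
  have b2' : legN (s - 1) h <= legN (s - 1) 1 + (s - 1) * 3 `^ (s - 1 - 1) * e.
    by apply: (le_trans b2); rewrite lerD2l hE1; apply: ler_wpM2r; [exact: ltW|exact: ler_wpM2l].
  exact: (legN1_rec_approx s2 e0 e1 hE N10 (ltW (legN_gt0 _ h1)) n2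
    (introT andP (conj a1 a2')) (introT andP (conj b1 b2')) (legN_rec s h1)).
apply/eqP; rewrite -normr_le0 leNgt; apply/negP.
move: C C0 XC; move: (`|X|) => x C C0 XC x0.
(* Chosen so that C e is less than x, against the bound [XC]. *)
pose e := Num.min 2^-1 (x / (2 * (C + 1))).
have e0 : 0 < e by rewrite lt_min divr_gt0//; lra.
have e1 : e < 1 by rewrite gt_min; apply/orP; left; lra.
have e2 : e <= x / (2 * (C + 1)) by rewrite ge_min lexx orbT.
have := XC e e0 e1; apply/negP; rewrite -ltNge.
apply: (le_lt_trans (y := C * (x / (2 * (C + 1))))); first exact: ler_wpM2l.
rewrite mulrA ltr_pdivrMr; last lra.
by nra.
Qed.

End legendre.

(** * The linear two-point inequality *)

Section modulus_average.
Context {R : realType}.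
Implicit Types s x : R.

(** The mean of |1 + x e(t)|^(2s). *)
Definition avg_modulus s x : R := avg (fun t => (1 + x ^+ 2 + 2 * x * cosc t) `^ s).

Lemma sqr_modulus_ge0 x t : 0 <= x -> 0 <= 1 + x ^+ 2 + 2 * x * cosc t.
Proof.
move=> x0; have /andP[c1 c2] := cosc_bound t.
have -> : 1 + x ^+ 2 + 2 * x * cosc t = (1 - x) ^+ 2 + 2 * x * (1 + cosc t) by ring.
by rewrite addr_ge0 ?sqr_ge0// mulr_ge0//; lra.
Qed.

Lemma continuous_affcosc (a b : R) : continuous (fun t => a + b * cosc t).
Proof. by have := @continuous_lincosc R a b 1; under eq_fun do rewrite mul1r. Qed.

Lemma continuous_sqr_modulus_powR s x : 0 < s -> 0 <= x -> continuous (fun t => (1 + x ^+ 2 + 2 * x * cosc t) `^ s).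
Proof.
move=> s0 x0; apply: continuous_powR_ge0 => //; last exact: continuous_affcosc.
by move=> t; exact: sqr_modulus_ge0.
Qed.

Lemma avg_affcosc (a b : R) : avg (fun t => a + b * cosc t) = a.
Proof.
rewrite (avgD (f := fun=> a) (g := fun t => b * cosc t)).
- by rewrite avg_cst avgZ ?avg_cosc ?mulr0 ?addr0//; exact: continuous_cosc.
- by move=> t; exact: cvg_cst.
- by move=> t; apply: cvgM; [exact: cvg_cst|exact: continuous_cosc].
Qed.

Lemma avg_modulus_ge1 s x : 1 < s -> 0 <= x -> 1 <= avg_modulus s x.
Proof.
move=> s1 x0; have s0 : 0 < s by lra.
apply: (@le_trans _ _ (1 + s * x ^+ 2)).
  by rewrite lerDl mulr_ge0 ?sqr_ge0// ltW.
rewrite -(avg_affcosc (1 + s * x ^+ 2) (2 * s * x)).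
apply: le_avg; [exact: continuous_affcosc|exact: continuous_sqr_modulus_powR|].
move=> t; have := powR_ge_tangent s1 ler01 (sqr_modulus_ge0 t x0).
rewrite !powR1; apply: le_trans.
by rewrite le_eqVlt; apply/orP; left; apply/eqP; ring.
Qed.

(** With a = s v the chain is (1 + v)^s <= e^a <= 1/(1 - a) <= 1 + a + 2 a^2, the last step because
    a <= 1/2. *)
Lemma powR1D_le s (v : R) : 0 < s -> -1 < v -> s * v <= 1 / 2 ->
  (1 + v) `^ s <= 1 + s * v + 2 * (s * v) ^+ 2.
Proof.
move=> s0 v1 sv.
have v10 : 0 < 1 + v by lra.
rewrite /powR gt_eqF//.
apply: (@le_trans _ _ (expR (s * v))).
  by rewrite ler_expR ler_pM2l// le_ln1Dx.
move: (s * v) sv => a a2.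
have a1 : 0 < 1 - a by lra.
have : expR a <= (1 - a)^-1.
  rewrite -[expR a]invrK -expRN lef_pV2 ?posrE ?expR_gt0//.
  exact: expR_ge1Dx.
move=> /le_trans; apply; rewrite -[leLHS]mul1r ler_pdivrMr//.
have : 0 <= a ^+ 2 * (1 - 2 * a) by rewrite mulr_ge0 ?sqr_ge0//; lra.
have -> : (1 + a + 2 * a ^+ 2) * (1 - a) = 1 + a ^+ 2 * (1 - 2 * a) by ring.
by move=> ?; rewrite lerDl.
Qed.

(** Apply [powR1D_le] with v = x^2 + 2 x cos. The condition 6 s x <= 1 keeps s v <= 1/2, the bound
    |v| <= 3 x gives the constant 18, and the term linear in cos averages to 0. *)
Lemma avg_modulus_le s x : 1 < s -> 0 <= x -> 6 * s * x <= 1 ->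
  avg_modulus s x <= 1 + (s + 18 * s ^+ 2) * x ^+ 2.
Proof.
move=> s1 x0 sx; have s0 : 0 < s by lra.
have -> : 1 + (s + 18 * s ^+ 2) * x ^+ 2 = 1 + s * x ^+ 2 + 18 * s ^+ 2 * x ^+ 2 by ring.
rewrite -(avg_affcosc (1 + s * x ^+ 2 + 18 * s ^+ 2 * x ^+ 2) (2 * s * x)).
have x6 : 6 * x <= 1.
  by apply: le_trans sx; rewrite -mulrA ler_pM2l//; rewrite ler_peMl// ltW.
apply: le_avg; [exact: continuous_sqr_modulus_powR|exact: continuous_affcosc|].
move=> t; have /andP[c1 c2] := cosc_bound t.
move: (cosc t) c1 c2 => c c1 c2.
set v := x ^+ 2 + 2 * x * c.
have xx : x ^+ 2 <= x by rewrite expr2 ler_piMl//; lra.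
have xc : `|x * c| <= x by rewrite normrM (ger0_norm x0) ler_piMr// ler_norml c1.
have vx : `|v| <= 3 * x.
  rewrite /v -mulrA (le_trans (ler_normD _ _))// (ger0_norm (sqr_ge0 x)) normrM (ger0_norm (ler0n _ 2)).
  by lra.
have v9 : v ^+ 2 <= 9 * x ^+ 2.
  rewrite (_ : 9 * x ^+ 2 = (3 * x) ^+ 2); last by ring.
  by rewrite -(real_normK (num_real v)) lerXn2r// nnegrE mulr_ge0.
have v1 : -1 < v by move: vx; rewrite ler_norml => /andP[? _]; lra.
have sv : s * v <= 1 / 2.
  apply: (@le_trans _ _ (s * (3 * x))); last by lra.
  by rewrite ler_pM2l//; move: vx; rewrite ler_norml => /andP[].
rewrite -addrA -/v; apply: (le_trans (powR1D_le s0 v1 sv)).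
have : s ^+ 2 * v ^+ 2 <= s ^+ 2 * (9 * x ^+ 2) by rewrite ler_wpM2l// sqr_ge0.
rewrite exprMn; move: (v ^+ 2) => v2; rewrite /v; clear v v9 v1 sv vx; lra.
Qed.

(** Rests on ch T + cos(2 pi t) = (e^T / 2) |1 + e^(-T) e(t)|^2. *)
Lemma legN_chE s (T : R) : 0 < s -> legN s (ch T) = (expR T / 2) `^ s * avg_modulus s (expR (- T)).
Proof.
move=> s0; rewrite /legN /avg_modulus -avgZ; last exact: continuous_sqr_modulus_powR (expR_ge0 _).
apply: eq_avg => t; rewrite -powRM ?sqr_modulus_ge0 ?divr_ge0 ?expR_ge0//; congr powR.
have := expRxMexpNx_1 T; rewrite /ch.
move: (expR T) (expR (- T)) => x y xy.
have -> : x / 2 * (1 + y ^+ 2 + 2 * y * cosc t) = (x + (x * y) * y) / 2 + (x * y) * cosc t by field.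
by rewrite xy !mul1r.
Qed.

End modulus_average.

Lemma legN_avg (R : realType) (s h : R) : legN s h = avg (fun t => (h + cosc t) `^ s).
Proof. by []. Qed.

(* Keeps lra and ring from comparing integrals by unfolding them. *)
Local Opaque legN avg.

(** * The logarithmic defect [D] and its sign *)

Section two_point.
Context {R : realType}.
Variables s m : R.
Hypotheses (s1 : 1 < s) (m12 : 1 < 2 * m) (m1 : m < 1).

Let s0 : 0 < s. Proof. exact: lt_trans s1. Qed.
Let m0 : 0 < m. Proof. by rewrite -(pmulr_rgt0 m (ltr0Sn R 1)); exact: lt_trans m12. Qed.
Let L := s / m.
Let L0 : 0 < L. Proof. exact: divr_gt0. Qed.
Let Lm : L * m = s. Proof. by rewrite /L divfK ?gt_eqF. Qed.

Hypothesis base : ln (legN s 1) <= (L - s) * ln 2.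

(** [D T <= 0] is the two-point inequality for u/v = e^(2T), and [base] is the case T = 0. *)
Let D T := ln (legN s (ch T)) - L * ln (ch (m * T)) - (L - s) * ln 2.

Let legN_gt0' h : 1 <= h -> 0 < legN s h.
Proof.
move=> h1; apply: lt_le_trans (legN_ge s1 h1); rewrite ltr_pwDl//.
by rewrite mulr_ge0 ?subr_ge0// ltW.
Qed.

Let ch_ge1 (T : R) : 0 <= T -> 1 <= ch T.
Proof. by rewrite le_eqVlt => /predU1P[<-|/ch_gt1/ltW//]; rewrite ch0. Qed.

Let D0_le0 : D 0 <= 0.
Proof. by rewrite /D mulr0 ch0 ln1 mulr0 subr0 subr_le0. Qed.

(** Taking e^(sT) out of N_s(ch T) and e^(mT) out of ch(m T) cancels all growing terms, because L m
    = s; the multiples of ln 2 cancel as well. *)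
Let DE T : D T = ln (avg_modulus s (expR (- T))) - L * ln (1 + expR (- (2 * m * T))).
Proof.
have W0 : 0 < avg_modulus s (expR (- T)) by apply: lt_le_trans (avg_modulus_ge1 s1 (expR_ge0 _)).
have e20 : 0 < expR T / 2 by rewrite divr_gt0 ?expR_gt0.
rewrite /D legN_chE// lnM ?posrE ?powR_gt0// ln_powR ln_div ?posrE ?expR_gt0// expRK.
have -> : ch (m * T) = expR (m * T) / 2 * (1 + expR (- (2 * m * T))).
  rewrite /ch mulrDr mulr1 mulrAC -expRD mulrDl; congr (_ + _ / _); congr expR; ring.
rewrite lnM ?posrE ?divr_gt0 ?addr_gt0 ?expR_gt0// ln_div ?posrE ?expR_gt0// expRK.
move: (ln (avg_modulus _ _)) (ln (1 + _)) (ln 2) => a b c.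
by rewrite -{1 2}Lm; ring.
Qed.

(** A lower bound tending to 0 at infinity; the crude estimate e^(-y) <= 1/y suffices. *)
Let D_ge T : 0 < T -> - (L / (2 * m * T)) <= D T.
Proof.
move=> T0; rewrite DE.
have W0 : 0 <= ln (avg_modulus s (expR (- T))) by apply: ln_ge0; exact: avg_modulus_ge1 (expR_ge0 _).
have y0 : 0 < 2 * m * T by rewrite !mulr_gt0.
have : ln (1 + expR (- (2 * m * T))) <= (2 * m * T)^-1.
  apply: le_trans (le_ln1Dx _) _; first by apply: lt_trans (expR_gt0 _); lra.
  rewrite expRN lef_pV2 ?posrE ?expR_gt0//.
  by apply: le_trans (expR_ge1Dx _); lra.
rewrite -(ler_pM2l L0) -/(L / _); move: (L * ln _) (L / _) => a b.
by lra.
Qed.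

(** The first summand ensures 6 s e^(-T) <= 1, as [avg_modulus_le] requires; the second ensures L (1
    - m) T > s + 18 s^2. *)
Let TL := 6 * s + (s + 18 * s ^+ 2 + 1) / (L * (1 - m)).

(** Put x = e^(-T) and z = e^(-2mT) in [DE]. The first logarithm is at most C x^2, while ln(1 + z)
    >= z/2, and z = x^2 e^(2(1-m)T) outweighs x^2 because m < 1. *)
Let D_lt0 T : TL <= T -> D T < 0.
Proof.
set C := s + 18 * s ^+ 2; move=> TT.
have C0 : 0 < C by rewrite /C addr_gt0 ?mulr_gt0 ?exprn_gt0.
have Lm0 : 0 < L * (1 - m) by rewrite mulr_gt0// subr_gt0.
have q0 : 0 < (C + 1) / (L * (1 - m)) by rewrite divr_gt0// addr_gt0.
have T1 : 6 * s <= T by apply: le_trans TT; rewrite /TL lerDl ltW.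
have T2 : (C + 1) / (L * (1 - m)) <= T by apply: le_trans TT; rewrite /TL lerDr mulr_ge0// ltW.
have T0 : 0 < T by lra.
rewrite DE; set x := expR (- T); set z := expR _.
have x0 : 0 < x by exact: expR_gt0.
have z0 : 0 < z by exact: expR_gt0.
have z1 : z <= 1 by rewrite /z -expR0 ler_expR oppr_le0 !mulr_ge0// ltW.
have x6 : 6 * s * x <= 1.
  rewrite /x expRN ler_pdivrMr ?expR_gt0// mul1r.
  by apply: le_trans (expR_ge1Dx _); lra.
have : ln (avg_modulus s x) <= C * x ^+ 2.
  have := avg_modulus_le s1 (ltW x0) x6; rewrite -/C => h.
  apply: (@le_trans _ _ (ln (1 + C * x ^+ 2))).
    rewrite ler_ln ?posrE//; first by apply: lt_le_trans (avg_modulus_ge1 s1 (ltW x0)).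
    by rewrite addr_gt0// mulr_gt0// exprn_gt0.
  apply: le_ln1Dx; apply: lt_le_trans (mulr_ge0 (ltW C0) (sqr_ge0 _)); lra.
have lnz : z / 2 <= ln (1 + z).
  have z10 : 0 < 1 + z by rewrite addr_gt0.
  have := @le_ln1Dx R ((1 + z)^-1 - 1).
  rewrite (_ : 1 + ((1 + z)^-1 - 1) = (1 + z)^-1) ?lnV ?posrE//; last by ring.
  have V0 : 0 < (1 + z)^-1 by rewrite invr_gt0.
  move=> /(_ ltac:(lra)) h.
  have : z / 2 <= 1 - (1 + z)^-1.
    have -> : 1 - (1 + z)^-1 = z / (1 + z) by field; rewrite gt_eqF.
    by rewrite ler_pM2l// lef_pV2 ?posrE//; lra.
  by lra.
have zx : z = x ^+ 2 * expR (2 * (1 - m) * T).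
  by rewrite /x -expRM_natl -expRD; congr expR; ring.
have : C * x ^+ 2 < L * (z / 2).
  rewrite zx [X in _ < X](_ : _ = L * (expR (2 * (1 - m) * T) / 2) * x ^+ 2); last by ring.
  rewrite ltr_pM2r ?exprn_gt0//.
  have : (1 - m) * T <= expR (2 * (1 - m) * T) / 2.
    rewrite ler_pdivlMr//; apply: le_trans (expR_ge1Dx _); lra.
  rewrite -(ler_pM2l L0); apply: lt_le_trans.
  by move: T2; rewrite ler_pdivrMr//; lra.
have : L * (z / 2) <= L * ln (1 + z) by rewrite ler_pM2l.
by move: (ln _) (ln _) (C * _) (L * (z / 2)) (L * _) => *; lra.
Qed.

(** The derivative D' with denominators cleared: D' = k g with [k] positive, the shape that
    [interior_max_derive] expects. *)
Let g T := sh T * ch (m * T) * legN (s - 1) (ch T) - sh (m * T) * legN s (ch T).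
Let k T := s / (ch (m * T) * legN s (ch T)).

Let k_gt0 T : 0 < T -> 0 < k T.
Proof. by move=> T0; rewrite /k divr_gt0// mulr_gt0 ?ch_gt0 ?legN_gt0'// ch_ge1// ltW. Qed.

Let is_derive_legNch r (T : R) : 0 < T ->
  is_derive T 1 (fun u => legN r (ch u)) (r * legN (r - 1) (ch T) * sh T).
Proof.
by move=> T0; apply: is_derive_fun_comp; [exact/is_derive_legN/ch_gt1|exact: is_derive_ch].
Qed.

Let is_derive_lnch (T : R) : is_derive T 1 (fun u => L * ln (ch (m * u)))
  (L * ((ch (m * T))^-1 * (sh (m * T) * m))).
Proof.
apply: is_derive_funZ; apply: (is_derive_fun_comp (f := @ln R)); last exact: is_derive_chM.
by apply: is_derive1_ln; exact: ch_gt0.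
Qed.

Let is_derive_D (T : R) : 0 < T -> is_derive T 1 D (k T * g T).
Proof.
move=> T0.
have N0 : 0 < legN s (ch T) by rewrite legN_gt0'// ch_ge1// ltW.
have c0 := ch_gt0 (m * T).
have -> : k T * g T = (legN s (ch T))^-1 * (s * legN (s - 1) (ch T) * sh T) -
     L * ((ch (m * T))^-1 * (sh (m * T) * m)) - 0.
  rewrite /k /g; move: (legN s (ch T)) (legN (s - 1) (ch T)) N0 => N N1 N0.
  have -> : L * ((ch (m * T))^-1 * (sh (m * T) * m)) = s * (sh (m * T) / ch (m * T)).
    by rewrite -{1}Lm; ring.
  by field; rewrite !gt_eqF.
have dc : is_derive T 1 (fun _ : R => (L - s) * ln 2) 0 := is_derive_cst _ _ _.
have dl := is_derive_fun_comp (f := @ln R) (g := fun u => legN s (ch u)) (is_derive1_ln N0) (is_derive_legNch s T0).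
exact: is_derive_funB (is_derive_funB dl (is_derive_lnch T)) dc.
Qed.

Let dg T := (ch T * ch (m * T) + sh T * (sh (m * T) * m)) * legN (s - 1) (ch T)
   + sh T * ch (m * T) * ((s - 1) * legN (s - 1 - 1) (ch T) * sh T)
   - (ch (m * T) * m * legN s (ch T) + sh (m * T) * (s * legN (s - 1) (ch T) * sh T)).

Let is_derive_g (T : R) : 0 < T -> is_derive T 1 g (dg T).
Proof.
move=> T0; apply: is_derive_funB; apply: is_derive_funM; try exact: is_derive_legNch.
  by apply: is_derive_funM; [exact: is_derive_sh|exact: is_derive_chM].
exact: is_derive_shM.
Qed.

(** Here [C], [S] are ch, sh at T, and [Cm], [Sm] those at m T. The recurrence eliminates [N2], the
    critical equation g = 0 eliminates [N1], and a multiple of [N0] remains. *)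
Lemma critical_point_identity (C S Cm Sm N0 N1 N2 : R) : C ^+ 2 - S ^+ 2 = 1 -> Cm ^+ 2 - Sm ^+ 2 = 1 ->
  s * N0 - (2 * s - 1) * C * N1 + (s - 1) * (C ^+ 2 - 1) * N2 = 0 ->
  S * Cm * N1 = Sm * N0 ->
  ((C * Cm + S * (Sm * m)) * N1 + S * Cm * ((s - 1) * N2 * S)
   - (Cm * m * N0 + Sm * (s * N1 * S))) * (S * Cm) =
  N0 * (s * (2 * C * Cm * Sm - S * (Cm ^+ 2 + Sm ^+ 2)) - m * S).
Proof.
move=> CS CSm rec gz.
have E1 : (s - 1) * S ^+ 2 * N2 = (2 * s - 1) * C * N1 - s * N0.
  apply/eqP; rewrite -subr_eq0; apply/eqP; rewrite -rec.
  by rewrite (_ : S ^+ 2 = C ^+ 2 - 1); [ring|rewrite -CS; ring].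
have -> : ((C * Cm + S * (Sm * m)) * N1 + S * Cm * ((s - 1) * N2 * S)
   - (Cm * m * N0 + Sm * (s * N1 * S))) * (S * Cm) =
   Cm ^+ 2 * S * ((s - 1) * S ^+ 2 * N2) + (C * Cm + m * S * Sm - s * Sm * S) * (S * Cm * N1)
   - m * Cm ^+ 2 * S * N0 by ring.
rewrite E1 (_ : Cm ^+ 2 * S * ((2 * s - 1) * C * N1 - s * N0) =
  (2 * s - 1) * C * Cm * (S * Cm * N1) - s * S * Cm ^+ 2 * N0); last by ring.
transitivity (N0 * (s * (2 * C * Cm * Sm - S * (Cm ^+ 2 + Sm ^+ 2)) - m * S * (Cm ^+ 2 - Sm ^+ 2))).
  by rewrite gz; ring.
by rewrite CSm mulr1.
Qed.

Let sh_2m T : sh ((2 * m - 1) * T) =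
  2 * ch T * ch (m * T) * sh (m * T) - sh T * (ch (m * T) ^+ 2 + sh (m * T) ^+ 2).
Proof.
rewrite /sh /ch.
have -> : (2 * m - 1) * T = m * T + m * T + - T by ring.
have -> : - (m * T + m * T + - T) = - (m * T) + - (m * T) + T by ring.
rewrite !expRD.
have := expRxMexpNx_1 T; have := expRxMexpNx_1 (m * T).
move: (expR T) (expR (- T)) (expR (m * T)) (expR (- (m * T))) => x y a b ab xy.
by field.
Qed.

Let dg_sign T : 0 < T -> g T = 0 -> dg T * (sh T * ch (m * T)) =
  legN s (ch T) * (s * sh ((2 * m - 1) * T) - m * sh T).
Proof.
move=> T0 /eqP; rewrite subr_eq0 => /eqP gT; rewrite /dg sh_2m.
apply: critical_point_identity => //; try exact: chsh.
by have := legN_rec s (ch_gt1 T0); rewrite (_ : s - 1 - 1 = s - 2)//; ring.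
Qed.

(** Differentiability settles T > 0. At T = 0, where ch T = 1, the bounds of [legN_lipschitz]
    squeeze N_s(ch T). *)
Let continuous_D b : 0 < b -> {within `[0, b], continuous D}.
Proof.
move=> b0; apply/continuous_within_itvP => //; split=> [x||].
- by rewrite in_itv/= => /andP[x0 _]; exact: is_derive_continuous (is_derive_D x0).
- rewrite /D; apply: cvgB; last exact: cvg_cst.
  apply: cvgB; last first.
    by apply: cvg_at_right_filter; exact: is_derive_continuous (is_derive_lnch 0).
  apply: (@cvg_comp _ _ _ (fun u => legN s (ch u)) (@ln R) _ (nbhs (legN s (ch 0)))); last first.
    by apply: continuous_ln; rewrite legN_gt0' ?ch_ge1.
  rewrite ch0.
  have cch : continuous (@ch R) by move=> u; exact: is_derive_continuous (is_derive_ch u).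
  have ch1 u : 0 < ch u + 1 :> R by rewrite addr_gt0 ?ch_gt0.
  have cup : continuous (fun u => legN s 1 + s * (ch u + 1) `^ (s - 1) * (ch u - 1)).
    move=> u; apply: cvgD; first exact: cvg_cst.
    apply: cvgM; last by apply: cvgB; [exact: cch|exact: cvg_cst].
    apply: cvgM; first exact: cvg_cst.
    by apply: (continuous_powR_pos ch1) => v; apply: cvgD; [exact: cch|exact: cvg_cst].
  apply: (squeeze_cvgr (f := cst (legN s 1)) (h := fun u => legN s 1 + s * (ch u + 1) `^ (s - 1) * (ch u - 1))).
  + near=> u; have u0 : 0 < u by [].
    exact: legN_lipschitz s1 (ch_ge1 (ltW u0)).
  + exact: cvg_cst.
  + by have := cvg_at_right_filter (cup 0); rewrite /= ch0 subrr mulr0 addr0.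
- by apply: cvg_at_left_filter; exact: is_derive_continuous (is_derive_D b0).
Unshelve. all: by end_near.
Qed.

Lemma legN_ch_le T : 0 <= T -> D T <= 0.
Proof.
rewrite le_eqVlt => /predU1P[<-//|T_gt0].
rewrite leNgt; apply/negP => DT.
pose B := Num.max (T + 1) TL.
have TB : T < B by rewrite lt_max; apply/orP; left; lra.
have B0 : 0 < B by lra.
have DB : D B < 0 by apply: D_lt0; rewrite le_max lexx orbT.
(* This maximum is interior, since D is at most 0 at both ends and positive at T. *)
have [T0 T0B T0max] := EVT_max (ltW B0) (continuous_D B0).
have DT0 : 0 < D T0 by apply: lt_le_trans DT (T0max _ _); rewrite in_itv/= !ltW.
have {T0B} [T00 T0B] : 0 < T0 /\ T0 < B.
  move: T0B; rewrite in_itv/= => /andP[a b]; rewrite !lt_neqAle a b !andbT.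
  by split; apply/eqP => E; move: DT0; [rewrite -E|rewrite E]; apply/negP; rewrite -leNgt// ltW.
have [gT0 dgT0] : g T0 = 0 /\ dg T0 <= 0.
  apply: (@interior_max_derive R D k g 0 B T0 (dg T0)).
  - by rewrite T00.
  - by move=> z /andP[z0 _]; exact: k_gt0.
  - by move=> z /andP[z0 _]; exact: is_derive_D.
  - exact: is_derive_g.
  - by move=> z /andP[z0 zB]; apply: T0max; rewrite in_itv/= !ltW.
(* Large enough that the bound of [D_ge] at [B2] exceeds D B. As D T0 > 0 > D B too, the minimum
   over [T0, B2] is interior. *)
pose B2 := B + L / (2 * m * - D B).
have mD : 0 < 2 * m * - D B by rewrite !mulr_gt0// oppr_gt0.
have BB2 : B < B2 by rewrite ltrDl divr_gt0.
have DB2 : D B < D B2.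
  apply: lt_le_trans (D_ge _); last lra.
  rewrite ltrNr ltr_pdivrMr; last by rewrite !mulr_gt0//; lra.
  rewrite /B2 (_ : - D B * _ = 2 * m * - D B * B + L / (2 * m * - D B) * (2 * m * - D B)); last by ring.
  by rewrite divfK ?gt_eqF// ltrDr mulr_gt0.
have cD2 : {within `[T0, B2], continuous D}.
  apply: (@is_derive_within_continuous _ _ (fun z => k z * g z)) => z /andP[z0 _].
  exact: is_derive_D (lt_le_trans T00 z0).
have [T1 T1B T1min] := EVT_min (ltW (lt_trans T0B BB2)) cD2.
have DT1 : D T1 <= D B by apply: T1min; rewrite in_itv/= !ltW.
have {T1B} [T01 T1B] : T0 < T1 /\ T1 < B2.
  move: T1B; rewrite in_itv/= => /andP[a b]; rewrite !lt_neqAle a b !andbT.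
  by split; apply/eqP => E; move: DT1; [rewrite -E|rewrite E]; apply/negP; rewrite -ltNge// (lt_trans DB).
have [gT1 dgT1] : - g T1 = 0 /\ - dg T1 <= 0.
  apply: (@interior_max_derive R (fun z => - D z) k (fun z => - g z) T0 B2 T1 (- dg T1)).
  - by rewrite T01.
  - by move=> z /andP[z0 _]; exact: k_gt0 (lt_trans T00 z0).
  - by move=> z /andP[z0 _]; rewrite mulrN; apply: is_deriveN; exact: is_derive_D (lt_trans T00 z0).
  - by apply: is_deriveN; exact: is_derive_g (lt_trans T00 T01).
  - by move=> z /andP[z0 zB]; rewrite lerN2; apply: T1min; rewrite in_itv/= !ltW.
have T10 := lt_trans T00 T01.
have := dg_sign T00 gT0; have := dg_sign T10 (oppr_inj (etrans gT1 (esym (oppr0 _)))).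
move=> E1 E0.
have S0 := sh_gt0 T00. have S1 := sh_gt0 T10.
(* By [dg_sign], the quotient s sh((2m-1)T) / (m sh T) is at most 1 at the maximum T0 and at least 1
   at the later minimum T1, although it strictly decreases. *)
have w0 : s * sh ((2 * m - 1) * T0) <= m * sh T0.
  rewrite -subr_le0 -(pmulr_rle0 _ (legN_gt0' (ch_ge1 (ltW T00)))) -E0.
  by rewrite pmulr_lle0// mulr_gt0// ch_gt0.
have w1 : m * sh T1 <= s * sh ((2 * m - 1) * T1).
  rewrite -subr_ge0 -(pmulr_rge0 _ (legN_gt0' (ch_ge1 (ltW T10)))) -E1.
  by apply: mulr_ge0; [rewrite -oppr_le0|rewrite ltW// mulr_gt0// ch_gt0].
have a01 : 0 < 2 * m - 1 < 1.
  apply/andP; split; first by rewrite subr_gt0.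
  by rewrite ltrBlDr -[ltRHS]mulr1 ltr_pM2l.
have := sh_ratio_decr a01 T00 T01; apply/negP; rewrite -leNgt -(ler_pM2l s0).
have h0 := ler_wpM2r (ltW S1) w0; have h1 := ler_wpM2r (ltW S0) w1.
rewrite mulrA [leRHS]mulrA; apply: (le_trans h0).
by rewrite mulrAC; exact: h1.
Qed.

Lemma powR_expR (x y : R) : expR x `^ y = expR (x * y).
Proof. by rewrite /powR gt_eqF ?expR_gt0// expRK mulrC. Qed.

(** The integrand is |sqrt u + sqrt v e(t)|^(2s). Homogeneity reduces the claim to the ratio u/v,
    where it is [legN_ch_le]. *)
Lemma two_point (u v : R) : 0 <= u -> 0 <= v ->
  avg (fun t => (u + v + 2 * Num.sqrt (u * v) * cosc t) `^ s) <= (u `^ m + v `^ m) `^ (s / m).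
Proof.
wlog vu : u v / v <= u.
  move=> H u0 v0; have [vu|/ltW uv] := leP v u; first exact: H.
  by rewrite (addrC u) (mulrC u) (addrC (u `^ m)); exact: H.
move=> u0; rewrite le_eqVlt => /predU1P[<-|v0].
  rewrite mulr0 sqrtr0 powR0 ?gt_eqF// !addr0 -powRrM -/L [m * L]mulrC Lm.
  rewrite (_ : (fun t => _) = fun=> u `^ s) ?avg_cst//.
  by apply/funext => t; rewrite mulr0 mul0r addr0.
have {}u0 : 0 < u by exact: lt_le_trans vu.
(* So u = e^(p+T) and v = e^(p-T), with T >= 0 by the choice v <= u; a factor e^(ps) will come out
   of both sides. *)
pose T := (ln u - ln v) / 2; pose p := (ln u + ln v) / 2.
have T0 : 0 <= T by rewrite divr_ge0// subr_ge0 ler_ln.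
have uE : u = expR (p + T) by rewrite (_ : p + T = ln u) ?lnK// /p /T; field.
have vE : v = expR (p - T) by rewrite (_ : p - T = ln v) ?lnK// /p /T; field.
have sE : Num.sqrt (u * v) = expR p.
  rewrite uE vE -expRD (_ : p + T + (p - T) = p + p); last by ring.
  by rewrite expRD -expr2 sqrtr_sqr ger0_norm// expR_ge0.
have -> : avg (fun t => (u + v + 2 * Num.sqrt (u * v) * cosc t) `^ s) =
    (2 * expR p) `^ s * legN s (ch T).
  rewrite legN_avg -avgZ; last exact: (continuous_addcosc_powR_ge s0 (ch_ge1 T0)).
  apply: eq_avg => t; rewrite -powRM ?mulr_ge0 ?expR_ge0//; last first.
    by rewrite addcosc_ge0// ch_ge1.
  by rewrite sE uE vE !expRD /ch; congr (_ `^ _); field.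
have -> : u `^ m + v `^ m = expR (m * p) * (2 * ch (m * T)).
  rewrite uE vE !powR_expR mulrDl mulrBl !expRD /ch [p * m]mulrC [T * m]mulrC.
  by move: (expR _) (expR _) (expR _) => x y z; field.
have c0 := ltW (ch_gt0 (m * T)).
rewrite -/L [in leLHS]powRM ?expR_ge0// powR_expR.
rewrite [in leRHS]powRM ?mulr_ge0 ?expR_ge0// powR_expR.
rewrite (_ : m * p * L = p * s); last by rewrite -Lm; ring.
rewrite [_ * expR _]mulrC -mulrA ler_pM2l ?expR_gt0//.
have N0 := legN_gt0' (ch_ge1 T0).
have := legN_ch_le T0; rewrite /D => h.
rewrite -ler_ln ?posrE ?mulr_gt0 ?powR_gt0 ?mulr_gt0 ?ch_gt0//.
rewrite lnM ?posrE ?powR_gt0// !ln_powR lnM ?posrE ?ch_gt0//.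
  rewrite -subr_le0; apply: le_trans h; rewrite le_eqVlt; apply/orP; left; apply/eqP.
  by ring.
by rewrite addr_gt0 ?expR_gt0.
Qed.

End two_point.

(** * Comparison with the central binomial coefficient *)

Section gamma_integral.
Context {R : realType}.
Notation mu := (@lebesgue_measure R).
Implicit Types a t : R.

Lemma integrable_EFinZ (D : set R) (f : R -> R) k : measurable D ->
  mu.-integrable D (EFin \o f) -> mu.-integrable D (EFin \o (fun t => k * f t)).
Proof. by move=> mD; exact: integrableZl. Qed.

Lemma integrable_EFinD (D : set R) (f g : R -> R) : measurable D ->
  mu.-integrable D (EFin \o f) -> mu.-integrable D (EFin \o g) ->
  mu.-integrable D (EFin \o (fun t => f t + g t)).
Proof. by move=> mD; exact: integrableD. Qed.

Lemma integrable_EFinB (D : set R) (f g : R -> R) : measurable D ->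
  mu.-integrable D (EFin \o f) -> mu.-integrable D (EFin \o g) ->
  mu.-integrable D (EFin \o (fun t => f t - g t)).
Proof. by move=> mD; exact: integrableB. Qed.

(** The integrand of Gamma(a + 1); the absolute value makes it continuous on the whole line when a
    >= 0. *)
Definition gammaK a t : R := `|t| `^ a * expR (- t).

Lemma continuous_expRN k : continuous (fun t : R => expR (- (k * t))).
Proof.
move=> t; apply: (is_derive_continuous (a := expR (- (k * t)) * - k)).
apply: is_derive_fun_comp.
have -> : (fun t : R => - (k * t)) = (fun t => (- k) * t) by apply/funext => u; rewrite mulNr.
exact: is_derive_scal.
Qed.

Lemma continuous_gammaK a : 0 <= a -> continuous (gammaK a).
Proof.
move=> a0 t; apply: cvgM; last first.
  exact: is_derive_continuous (is_derive_expRN t).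
move: a0; rewrite le_eqVlt => /predU1P[<-|a0].
  by under eq_fun do rewrite powRr0; rewrite powRr0; exact: cvg_cst.
by apply: (continuous_powR_ge0 a0 (f := fun t : R => `|t|)) => // u; exact: norm_continuous.
Qed.

Lemma gammaK_ge0 a t : 0 <= gammaK a t.
Proof. by rewrite mulr_ge0 ?powR_ge0 ?expR_ge0. Qed.

(** Put b = 2(a + 1). Raising t <= b e^(t/b) to the power a gives t^a <= b^a e^(t/2), since a/b <=
    1/2. *)
Lemma gammaK_le a t : 0 <= a -> 0 <= t -> gammaK a t <= (2 * (a + 1)) `^ a * expR (- (2^-1 * t)).
Proof.
move=> a0 t0; rewrite /gammaK ger0_norm//.
have b0 : 0 < 2 * (a + 1) by lra.
have -> : expR (- t) = expR (- (2^-1 * t)) * expR (- (2^-1 * t)).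
  by rewrite -expRD; congr expR; field.
rewrite mulrA ler_pM2r ?expR_gt0// expRN ler_pdivrMr ?expR_gt0//.
have h : t <= 2 * (a + 1) * expR (t / (2 * (a + 1))).
  rewrite mulrC -ler_pdivrMr//; apply: le_trans (expR_ge1Dx _); lra.
apply: (@le_trans _ _ ((2 * (a + 1) * expR (t / (2 * (a + 1)))) `^ a)).
  by apply: ge0_ler_powR => //; rewrite nnegrE// mulr_ge0 ?expR_ge0// ltW.
rewrite powRM ?expR_ge0 ?(ltW b0)// ler_wpM2l ?powR_ge0// powR_expR ler_expR.
rewrite mulrAC [leRHS]mulrC ler_pdivrMr// -mulrA ler_wpM2l//.
lra.
Qed.

Lemma integral_expRN k : 0 < k ->
  (\int[mu]_(t in `[0%R, +oo[) (expR (- (k * t)))%:E = (k^-1)%:E)%E.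
Proof.
move=> k0.
have dF (t : R) : is_derive t 1 (fun t => - k^-1 * expR (- (k * t))) (expR (- (k * t))).
  have -> : expR (- (k * t)) = - k^-1 * (expR (- (k * t)) * - k).
    by field; rewrite gt_eqF.
  apply: is_derive_funZ.
  apply: is_derive_fun_comp.
  have -> : (fun t : R => - (k * t)) = (fun t => (- k) * t) by apply/funext => u; rewrite mulNr.
  exact: is_derive_scal.
rewrite (@ge0_continuous_FTC2y R (fun t => expR (- (k * t))) (fun t => - k^-1 * expR (- (k * t))) 0 0).
- by rewrite mulr0 oppr0 expR0 mulr1 -EFinB sub0r opprK.
- by move=> x _; exact: expR_ge0.
- exact/continuous_subspaceT/continuous_expRN.
- rewrite -[X in _ --> X](mulr0 (- k^-1)); apply: cvgM; first exact: cvg_cst.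
  apply: (@cvg_comp _ _ _ (fun t => k * t) (fun t => expR (- t)) _ +oo); last exact: cvgr_expR.
  exact: gt0_cvgMry.
- by move=> x _; exact: (@ex_derive _ _ _ _ _ _ _ (dF x)).
- by apply: cvg_at_right_filter; exact: is_derive_continuous (dF 0).
- by move=> x _; rewrite derive1E; exact: (@derive_val _ _ _ _ _ _ _ (dF x)).
Qed.

Lemma integrable_gammaK a : 0 <= a -> mu.-integrable `[0, +oo[ (EFin \o gammaK a).
Proof.
move=> a0; apply: (@le_integrable _ _ _ mu _ _ _ (EFin \o (fun t => (2 * (a + 1)) `^ a * expR (- (2^-1 * t))))) => //.
- have mg : measurable_fun setT (gammaK a).
    by apply: continuous_measurable_fun; exact: continuous_gammaK.
  exact/measurable_EFinP/measurable_funTS.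
- move=> t; rewrite /= in_itv/= andbT => t0.
  by rewrite lee_fin !ger0_norm ?gammaK_ge0 ?gammaK_le// mulr_ge0 ?powR_ge0 ?expR_ge0.
- apply: (@integrable_EFinZ _ (fun t => expR (- (2^-1 * t)))) => //.
  apply/integrableP; split.
    have me : measurable_fun setT (fun t : R => expR (- (2^-1 * t))).
      by apply: continuous_measurable_fun; exact: continuous_expRN.
    exact/measurable_EFinP/measurable_funTS.
  under eq_integral do rewrite abse_EFin ger0_norm ?expR_ge0//.
  by rewrite integral_expRN ?ltry// invr_gt0.
Qed.

Definition gint a : R := \int[mu]_(t in `[0, +oo[) gammaK a t.

Lemma GammaE a : 0 <= a -> Gamma (a + 1) = gint a.
Proof.
move=> a0; rewrite /Gamma /gint -Rintegral_itv_obnd_cbnd; last first.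
  by apply: integrableS (integrable_gammaK a0) => //; apply: subset_itvr; rewrite bnd_simp.
apply: eq_Rintegral => t; rewrite inE/= in_itv/= andbT => t0.
by rewrite addrK /gammaK ger0_norm// ltW.
Qed.

Lemma gint0 : gint 0 = 1.
Proof.
rewrite /gint (_ : gammaK 0 = fun t => expR (- (1 * t))).
  by rewrite /Rintegral integral_expRN// invr1.
by apply/funext => t; rewrite /gammaK powRr0 !mul1r.
Qed.

(** Integration by parts: -t^(a+1) e^(-t) is a primitive of the difference [f] of the two integrands
    and vanishes at 0 and at infinity. *)
Lemma gint_rec a : 0 <= a -> gint (a + 1) = (a + 1) * gint a.
Proof.
move=> a0; have a10 : 0 < a + 1 by lra.
have ia := integrable_gammaK a0; have ia1 := integrable_gammaK (ltW a10).
pose f t := gammaK (a + 1) t - (a + 1) * gammaK a t.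
pose F t := - (t `^ (a + 1) * expR (- t)).
have iaZ : mu.-integrable `[0, +oo[ (EFin \o (fun t => (a + 1) * gammaK a t)).
  exact: integrable_EFinZ.
suff : \int[mu]_(t in `[0, +oo[) f t = 0.
  rewrite /f RintegralB//= RintegralZl//= => /eqP.
  by rewrite subr_eq0 => /eqP.
have if_ : mu.-integrable `[0, +oo[ (EFin \o f).
  exact: integrable_EFinB.
have cf : continuous f.
  move=> t; apply: cvgB; first exact/continuous_gammaK/ltW.
  by apply: cvgM; [exact: cvg_cst|exact: continuous_gammaK].
have gkS t : 0 <= t -> gammaK (a + 1) t = t * gammaK a t.
  move=> t0; rewrite /gammaK ger0_norm//.
  by rewrite -(mulr_powRB1 t0 a10) addrK mulrA.
have dF t : 0 < t -> is_derive t 1 F (f t).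
  move=> t0; rewrite /f (gkS t (ltW t0)).
  have e : t * gammaK a t - (a + 1) * gammaK a t = -1 * ((a + 1) * t `^ (a + 1 - 1) * expR (- t) +
      t `^ (a + 1) * - expR (- t)).
    rewrite /gammaK gtr0_norm// addrK -(mulr_powRB1 (ltW t0) a10) addrK; ring.
  rewrite e /F; under eq_fun do rewrite -mulN1r.
  apply: is_derive_funZ; apply: is_derive_funM; last exact: is_derive_expRN.
  exact: is_derive1_powR.
have F0 : F 0 = 0 by rewrite /F powR0 ?mul0r ?oppr0// gt_eqF.
have F0r : F x @[x --> 0^'+] --> F 0.
  have : t `^ (a + 1) * expR (- t) @[t --> 0^'+] --> 0 * expR (- 0).
    apply: cvgM; first exact: powR_cvg0.
    by apply: cvg_at_right_filter; exact: is_derive_continuous (is_derive_expRN 0).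
  by move=> /cvgN; rewrite mul0r oppr0 F0.
(* [f] changes sign at a + 1, and the fundamental theorem on a half-line is applied to a nonnegative
   integrand, so the integral is cut there. *)
rewrite -(subrK (\int[mu]_(t in `[0, a + 1]) f t) (\int[mu]_(t in _) f t)).
rewrite Rintegral_itvB ?bnd_simp//; last exact: ltW.
rewrite Rintegral_itv_obnd_cbnd; last by apply: integrableS if_ => //; apply: subset_itvr; rewrite bnd_simp ltW.
rewrite (@Rintegral_ge0_continuous_FTC2y R f F (a + 1) 0).
- rewrite /Rintegral (@continuous_FTC2 R f F 0 (a + 1))//.
  + by rewrite -EFinB/= F0; ring.
  + exact: continuous_subspaceT.
  + split => //.
    * by move=> x; rewrite in_itv/= => /andP[x0 _]; exact: (@ex_derive _ _ _ _ _ _ _ (dF x x0)).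
    * by apply: cvg_at_left_filter; exact: is_derive_continuous (dF _ a10).
  + by move=> x; rewrite in_itv/= => /andP[x0 _]; rewrite derive1E; exact: (@derive_val _ _ _ _ _ _ _ (dF x x0)).
- move=> x ax; rewrite /f gkS; last lra.
  by rewrite -mulrBl mulr_ge0 ?gammaK_ge0// subr_ge0.
- exact: continuous_subspaceT.
- pose C := (2 * (a + 1 + 1)) `^ (a + 1).
  have e0 : C * expR (- (2^-1 * t)) @[t --> +oo] --> C * 0.
    apply: cvgM; first exact: cvg_cst.
    apply: (@cvg_comp _ _ _ (fun t => 2^-1 * t) (fun t => expR (- t)) _ +oo); last exact: cvgr_expR.
    by apply: gt0_cvgMry; rewrite ?invr_gt0//; exact: cvg_id.
  rewrite mulr0 in e0; rewrite -oppr0; apply: cvgN.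
  apply: (squeeze_cvgr (f := cst 0) (h := fun t => C * expR (- (2^-1 * t)))) => //; last exact: cvg_cst.
  near=> t; have t0 : 0 <= t by [].
  by have := gammaK_le (ltW a10) t0; have := gammaK_ge0 (a + 1) t; rewrite /gammaK ger0_norm// => -> ->.
- by move=> x ax; exact: (@ex_derive _ _ _ _ _ _ _ (dF x (lt_trans a10 ax))).
- by apply: cvg_at_right_filter; exact: is_derive_continuous (dF _ a10).
- move=> x; rewrite in_itv/= andbT => ax; rewrite derive1E.
  exact: (@derive_val _ _ _ _ _ _ _ (dF x (lt_trans a10 ax))).
Unshelve. all: by end_near.
Qed.

(* Bound t^e by its tangent at t = a + 1, whose linear part integrates to 0 against
   t^a e^-t because gint (a + 1) = (a + 1) gint a. *)
Lemma gint_le_shift a e : 0 <= a -> 0 <= e <= 1 -> gint (a + e) <= (a + 1) `^ e * gint a.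
Proof.
move=> a0 /andP[]; rewrite le_eqVlt => /predU1P[<- _|e0]; first by rewrite addr0 powRr0 mul1r.
rewrite le_eqVlt => /predU1P[->|e1].
  by rewrite gint_rec// powRr1//; lra.
have m0 : 0 < a + 1 by lra.
have -> : (a + 1) `^ e * gint a = (a + 1) `^ e * (1 - e) * gint a +
    (a + 1) `^ e * e / (a + 1) * gint (a + 1).
  by rewrite gint_rec//; field; lra.
have ia := integrable_gammaK a0; have ia1 := integrable_gammaK (ltW m0).
rewrite /gint -!RintegralZl// -RintegralD//; last 2 first.
- exact: integrable_EFinZ.
- exact: integrable_EFinZ.
apply: le_Rintegral => //.
- by apply: integrable_gammaK; lra.
- apply: integrable_EFinD => //.
  + exact: integrable_EFinZ.
  + exact: integrable_EFinZ.
move=> t; rewrite /= in_itv/= andbT => t0.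
have gkD r s : 0 <= r -> 0 < s -> gammaK (r + s) t = t `^ s * gammaK r t.
  move=> r0 s0; rewrite /gammaK ger0_norm// powRD; first by rewrite mulrA [_ `^ s * _]mulrC.
  by rewrite gt_eqF//; lra.
rewrite !gkD// powRr1// mulrA -mulrDl ler_wpM2r ?gammaK_ge0//.
(* The tangent bound for the concave t^e is that of the convex x^(1/e), taken at (a + 1)^e and
   evaluated at t^e. *)
have s1 : 1 < e^-1 by rewrite invf_gt1.
have := powR_ge_tangent s1 (powR_ge0 (a + 1) e) (powR_ge0 t e).
rewrite -!powRrM mulfV ?gt_eqF// !powRr1 ?(ltW m0)//.
rewrite (_ : e * (e^-1 - 1) = 1 - e); last by field; rewrite gt_eqF.
rewrite powRB ?(gt_eqF m0) ?implybT// powRr1 ?(ltW m0)//.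
have M0 : 0 < (a + 1) `^ e by rewrite powR_gt0.
move: (t `^ e) ((a + 1) `^ e) M0 => y M M0.
have -> : a + 1 + e^-1 * ((a + 1) / M) * (y - M) = (a + 1) * (1 + e^-1 * (y / M - 1)).
  by field; rewrite !gt_eqF.
rewrite mulrC -ler_pdivlMr// => h.
have : e^-1 * (y / M - 1) <= t / (a + 1) - 1 by lra.
rewrite ler_pdivrMl// lerBlDr ler_pdivrMr// => /le_trans; apply.
by rewrite le_eqVlt; apply/orP; left; apply/eqP; field; rewrite gt_eqF.
Qed.

(** Integrate the tangent of t^(1+d) at t = a against t^(a-1) e^(-t), a weight whose mean is a
    because gint(a) = a gint(a - 1). *)
Lemma gint_ge_shift a d : 1 <= a -> 0 <= d -> a `^ d * gint a <= gint (a + d).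
Proof.
move=> a1; rewrite le_eqVlt => /predU1P[<-|d0]; first by rewrite addr0 powRr0 mul1r.
have a0 : 0 < a by lra.
have b0 : 0 <= a - 1 by lra.
have ga : gint a = a * gint (a - 1) by rewrite -{1}(subrK 1 a) gint_rec// subrK.
have -> : a `^ d * gint a = - (a `^ d * a * d) * gint (a - 1) + (1 + d) * a `^ d * gint a.
  by rewrite ga; ring.
have ia := integrable_gammaK b0; have ia1 := integrable_gammaK (ltW a0).
rewrite /gint -!RintegralZl// -RintegralD//; last 2 first.
- exact: integrable_EFinZ.
- exact: integrable_EFinZ.
apply: le_Rintegral => //.
- apply: integrable_EFinD => //.
  + exact: integrable_EFinZ.
  + exact: integrable_EFinZ.
- by apply: integrable_gammaK; lra.
move=> t; rewrite /= in_itv/= andbT => t0.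
have gkD s : 0 < s -> gammaK (a - 1 + s) t = t `^ s * gammaK (a - 1) t.
  move=> s0; rewrite /gammaK ger0_norm// powRD; first by rewrite mulrA [_ `^ s * _]mulrC.
  by rewrite gt_eqF//; lra.
have -> : gammaK a t = t * gammaK (a - 1) t by have := gkD _ ltr01; rewrite subrK powRr1.
rewrite (_ : a + d = a - 1 + (1 + d)); last by ring.
rewrite gkD; last lra.
rewrite mulrA -mulrDl ler_wpM2r ?gammaK_ge0//.
have s1 : 1 < 1 + d by lra.
have := powR_ge_tangent s1 (ltW a0) t0.
have e1 : a `^ (1 + d) = a * a `^ d by rewrite powRD ?(gt_eqF a0) ?implybT// powRr1// ltW.
rewrite e1 (_ : 1 + d - 1 = d); last by ring.
by move: (t `^ _) (a `^ d) => y A; apply: le_trans; rewrite le_eqVlt; apply/orP; left; apply/eqP; ring.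
Qed.

Lemma gint_gt0 a : 1 <= a -> 0 < gint a.
Proof.
move=> a1; have g1 : gint 1 = 1.
  by have := gint_rec (lexx 0); rewrite add0r gint0 mulr1.
have a10 : 0 <= a - 1 by rewrite subr_ge0.
have := gint_ge_shift (lexx 1) a10.
by rewrite g1 powR1 mul1r addrC subrK; apply: lt_le_trans.
Qed.

(** The starting value for [rho_nat]. The mean of cos^2 comes from integrating the derivative of sin
    cos. *)
Lemma legN2 : legN 2 1 = 3 / 2 :> R.
Proof.
have cc2 : continuous (fun t : R => cosc t ^+ 2).
  by under eq_fun do rewrite expr2; move=> t; apply: cvgM; exact: continuous_cosc.
have ac2 : avg (fun t : R => cosc t ^+ 2) = 1 / 2.
  have cf : continuous (fun t : R => 2 * pi * (-1 + 2 * cosc t ^+ 2)).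
    move=> t; apply: cvgM; first exact: cvg_cst.
    apply: cvgD; first exact: cvg_cst.
    by apply: cvgM; [exact: cvg_cst|exact: cc2].
  have := avg_derive (F := fun t => sinc t * cosc t) cf.
  rewrite sinc0 sinc1 !mul0r subrr => H.
  have {}H : avg (fun t : R => 2 * pi * (-1 + 2 * cosc t ^+ 2)) = 0.
    apply: H => t.
    have -> : 2 * pi * (-1 + 2 * cosc t ^+ 2) = cosc t * (2 * pi) * cosc t + sinc t * (- sinc t * (2 * pi)).
      transitivity (2 * pi * (- (cosc t ^+ 2 + sinc t ^+ 2) + 2 * cosc t ^+ 2)).
        by rewrite cos2Dsin2c.
      by ring.
    by apply: is_derive_funM; [exact: is_derive_sinc|exact: is_derive_cosc].
  move: H; rewrite avgZ; last first.
    move=> t; apply: cvgD; first exact: cvg_cst.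
    by apply: cvgM; [exact: cvg_cst|exact: cc2].
  rewrite avgD; [|by move=> t; exact: cvg_cst|by move=> t; apply: cvgM; [exact: cvg_cst|exact: cc2]].
  rewrite avg_cst avgZ// => /eqP; rewrite mulf_eq0 gt_eqF ?mulr_gt0 ?pi_gt0//= => /eqP.
  lra.
rewrite legN_avg (_ : (fun t => _) = fun t => 1 + 2 * cosc t + cosc t ^+ 2).
  rewrite (avgD (f := fun t => 1 + 2 * cosc t) (g := fun t => cosc t ^+ 2)).
  - by rewrite avg_affcosc ac2; field.
  - exact: continuous_affcosc.
  - exact: cc2.
apply/funext => t; rewrite powR_mulrn ?addcosc_ge0//; ring.
Qed.

Lemma sqr1D_lt (x r : R) : 0 < x -> x <= 1 -> 3 * x < r - 1 -> (1 + x) ^+ 2 < r.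
Proof.
move=> x0 x1; have : x ^+ 2 <= x by rewrite expr2 ler_piMl// ltW.
have -> : (1 + x) ^+ 2 = 1 + 2 * x + x ^+ 2 by ring.
by lra.
Qed.

(* rho is 1-periodic, equal to 1 at the integers >= 2, and nearly constant between
   consecutive large integers; hence rho <= 1. *)
Let rho s : R := 2 `^ s * legN s 1 * gint s ^+ 2 / gint (2 * s).

Let rhoS s : 1 < s -> rho (s + 1) = rho s.
Proof.
move=> s1; have [s0 [s10 s20]] : 0 < s /\ 0 < s + 1 /\ 0 < 2 * s + 1 by lra.
have s2 : 2 < s + 1 by lra.
have := legN1_rec s2; rewrite addrK (_ : 2 * (s + 1) - 1 = 2 * s + 1); last by ring.
move=> recN; have {}recN : legN (s + 1) 1 = (2 * s + 1) * legN s 1 / (s + 1).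
  by rewrite -recN mulrC mulKf// gt_eqF.
have g2 : 0 < gint (2 * s) by apply: gint_gt0; lra.
have s21 : 0 <= 2 * s by lra.
have e1 := gint_rec (ltW s0); have e2 := gint_rec s21; have e3 := gint_rec (ltW s20).
have e4 : 2 * (s + 1) = 2 * s + 1 + 1 by ring.
have e5 : 2 `^ (s + 1) = 2 `^ s * 2 :> R by rewrite powRD ?pnatr_eq0 ?implybT// powRr1.
rewrite /rho e4 e5 recN e1 e3 e2.
move: (2 `^ s) (legN s 1) (gint s) (gint (2 * s)) g2 => A N g g2 g20.
by clear -s0 s10 s20 g20; field; rewrite !gt_eqF//; lra.
Qed.

Let rhoDn s n : 1 < s -> rho (s + n%:R) = rho s.
Proof.
move=> s1; elim: n => [|n IH]; first by rewrite addr0.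
by rewrite -natr1 addrA rhoS// ltr_wpDr.
Qed.

Let rho_nat n : rho n.+2%:R = 1.
Proof.
rewrite -addn2 natrD addrC rhoDn ?ltr1n// /rho legN2 powR_mulrn//.
have gS k : gint k.+1%:R = k.+1%:R * gint k%:R by rewrite -natr1 gint_rec.
rewrite (_ : 2 * 2 = 4%:R); last by rewrite -natrM.
by rewrite !gS gint0; field.
Qed.

Let rho_aux (A N N' g g' G G' : R) : 0 <= A -> 0 <= N -> N <= N' -> 0 <= g -> g <= g' ->
  0 < G' -> G' <= G -> A * N * g ^+ 2 / G <= A * N' * g' ^+ 2 / G'.
Proof.
move=> A0 N0 NN g0 gg G0 GG; apply: ler_pM.
- by rewrite !mulr_ge0 ?sqr_ge0.
- by rewrite invr_ge0 (le_trans _ GG)// ltW.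
- apply: ler_pM; rewrite ?mulr_ge0 ?sqr_ge0 ?ler_wpM2l//.
  by rewrite lerXn2r// nnegrE (le_trans g0).
- by rewrite lef_pV2 ?posrE// (lt_le_trans G0).
Qed.

(** Let M = n + 2. As 1 + cos <= 2, N_(M+e)(1) <= 2^e N_M(1); with the two shift bounds on [gint]
    this gives rho(M + e) <= rho(M) ((M + 1)/M)^(2e), and rho(M) = 1. *)
Let rho_bound n e : 0 <= e <= 1 -> rho (n.+2%:R + e) <= (1 + n.+1%:R^-1) ^+ 2.
Proof.
move=> /[dup] e01 /andP[e0 e1]; have [M [ME rM]] : exists M : R, n.+2%:R = M /\ rho M = 1 by exists n.+2%:R.
rewrite ME; have [M0 [M1 MM]] : 0 < M /\ 1 <= M /\ 1 <= 2 * M.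
  by rewrite -ME ltr0n ler1n; split=> //; split=> //; rewrite -natrM ler1n.
have Nle : legN (M + e) 1 <= 2 `^ e * legN M 1.
  rewrite !legN_avg -avgZ; last exact: continuous_addcosc_powR_ge.
  apply: le_avg.
  - by apply: continuous_addcosc_powR_ge => //; rewrite ltr_wpDr.
  - by move=> t; apply: cvgM; [exact: cvg_cst|exact: continuous_addcosc_powR_ge].
  - move=> t; have c0 := addcosc_ge0 t (lexx 1).
    rewrite powRD; last by rewrite gt_eqF// ltr_wpDr.
    rewrite mulrC ler_wpM2r ?powR_ge0//.
    apply: ge0_ler_powR => //; rewrite ?nnegrE//.
    by have /andP[] := cosc_bound t; lra.
have gM := gint_gt0 M1; have g2M := gint_gt0 MM.
have g1 := gint_le_shift (ltW M0) e01.
have g2 := @gint_ge_shift (2 * M) (2 * e) MM (mulr_ge0 (ler0n _ 2) e0).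
have N0 : 0 <= legN (M + e) 1.
  by rewrite legN_avg -(avg_cst 0); apply: le_avg => [t||t]; [exact: cvg_cst| |exact: powR_ge0];
     apply: continuous_addcosc_powR_ge => //; rewrite ltr_wpDr.
have P0 : 0 < (2 * M) `^ (2 * e) by rewrite powR_gt0// mulr_gt0.
have Q0 : 0 < (M + 1) `^ e by rewrite powR_gt0// addr_gt0.
have gMe : 0 < gint (M + e) by apply: gint_gt0; rewrite ler_wpDr.
have NM : 0 <= legN M 1.
  by rewrite legN_avg -(avg_cst 0); apply: le_avg => [t||t]; [exact: cvg_cst|exact: continuous_addcosc_powR_ge|exact: powR_ge0].
apply: (@le_trans _ _ (2 `^ (M + e) * (2 `^ e * legN M 1) * ((M + 1) `^ e * gint M) ^+ 2 /
    ((2 * M) `^ (2 * e) * gint (2 * M)))).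
  rewrite /rho mulrDr.
  exact: rho_aux (powR_ge0 _ _) N0 Nle (ltW gMe) g1 (mulr_gt0 P0 g2M) g2.
have -> : 2 `^ (M + e) * (2 `^ e * legN M 1) * ((M + 1) `^ e * gint M) ^+ 2 /
    ((2 * M) `^ (2 * e) * gint (2 * M)) = rho M * ((M + 1) / M) `^ (2 * e).
  rewrite /rho [in RHS]powRM ?invr_ge0 ?addr_ge0 ?(ltW M0)//.
  rewrite -[M^-1]powR_inv1 ?(ltW M0)// -powRrM mulN1r powRN.
  rewrite [in LHS]powRM ?(ltW M0)// powRD ?pnatr_eq0 ?implybT//.
  have sq (x : R) : 0 < x -> x `^ (2 * e) = x `^ e ^+ 2.
    by move=> x0; rewrite mulrC powRrM powR_mulrn// powR_ge0.
  have M10 : 0 < M + 1 by rewrite addr_gt0.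
  rewrite !sq//.
  have a0 : 0 < 2 `^ e :> R by rewrite powR_gt0.
  have b0 : 0 < M `^ e by rewrite powR_gt0.
  move: (2 `^ M) (2 `^ e) (legN M 1) ((M + 1) `^ e) (gint M) (gint (2 * M)) (M `^ e) a0 b0 g2M
    => A a N q g gg b a0 b0 gg0.
  by field; rewrite !gt_eqF.
rewrite rM mul1r -powR_mulrn//.
apply: (@le_trans _ _ (((M + 1) / M) `^ 2%:R)).
  apply: ler_powR; last by rewrite -[leRHS]mulr1 ler_wpM2l.
  by rewrite ler_pdivlMr// mul1r lerDl.
apply: ge0_ler_powR; rewrite ?nnegrE ?divr_ge0 ?addr_ge0 ?invr_ge0 ?(ltW M0)//.
rewrite mulrDl mulfV ?gt_eqF// mul1r lerD2l lef_pV2 ?posrE ?ltr0n// -ME ler_nat.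
exact: ltnW.
Qed.

(** The claim is rho(s) <= 1. Integer shifts preserve rho and carry s to where [rho_bound] is as
    close to 1 as desired. *)
Lemma legN_le_central (s : R) : 1 < s -> 2 `^ s * legN s 1 <= central_binomial (2 * s).
Proof.
move=> s1; have s0 : 0 <= s by lra.
rewrite /central_binomial (_ : 2 * s / 2 = s); last by field.
rewrite !GammaE//; last by rewrite mulr_ge0.
have gs : 0 < gint s by apply: gint_gt0; rewrite ltW.
have g2s : 0 < gint (2 * s) by apply: gint_gt0; lra.
suff rs : rho s <= 1.
  rewrite ler_pdivlMr ?exprn_gt0//.
  by rewrite /rho (ler_pdivrMr _ _ g2s) mul1r in rs.
have rb n : rho s <= (1 + n.+1%:R^-1) ^+ 2.
  have /andP[t1 t2] := truncn_itv s0.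
  set k := Num.truncn s in t1 t2.
  have k0 : (0 < k)%N by rewrite truncn_gt0 ltW.
  rewrite -(rhoDn n.+1 s1).
  (* Integer part plus fractional part, in the form of [rho_bound]; s > 1 makes k positive, so
     [k.-1] is a true predecessor. *)
  have -> : s + n.+1%:R = (n + k.-1).+2%:R + (s - k%:R).
    rewrite -addnS prednK// -addSn natrD; ring.
  apply: le_trans (rho_bound _ _) _; first by rewrite subr_ge0 t1/= lerBlDl natr1 ltW.
  rewrite lerXn2r ?nnegrE ?addr_ge0 ?invr_ge0// lerD2l lef_pV2 ?posrE ?ltr0n//.
  by rewrite ler_nat ltnS leq_addr.
rewrite leNgt; apply/negP => r1.
have d0 : 0 < rho s - 1 by rewrite subr_gt0.
have := archi_boundP (ltW (divr_gt0 (ltr0Sn R 2) d0)); set n := Num.bound _ => hn.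
have n1 : 3 / (rho s - 1) < n.+1%:R by rewrite (lt_trans hn)// ltr_nat.
have := rb n; apply/negP; rewrite -ltNge.
have x0 : 0 < n.+1%:R^-1 :> R by rewrite invr_gt0 ltr0n.
have x1 : n.+1%:R^-1 <= 1 :> R by rewrite invf_le1 ?ler1n ?ltr0n.
have : 3 * n.+1%:R^-1 < rho s - 1 by rewrite ltr_pdivrMr ?ltr0n// mulrC -ltr_pdivrMr.
exact: sqr1D_lt.
Qed.

End gamma_integral.

(** * From the logarithmic to the linear expression *)

Section log_comparison.
Context {R : realType}.
Implicit Types u v y z : R.

(** Says that (e^y - 1)/y increases. Add y e^y times e^(z-y) > 1 + (z - y) to (z - y) e^y times
    e^(-y) >= 1 - y. *)
Lemma expR_ratio y z : 0 < y -> y < z -> z * (expR y - 1) < y * (expR z - 1).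
Proof.
move=> y0 yz; have z0 : 0 < z by exact: lt_trans yz.
have h1 : 1 + (z - y) < expR (z - y) by apply: expR_gt1Dx; rewrite subr_eq0 gt_eqF.
have h2 : 1 - y <= expR (- y) by exact: expR_ge1Dx.
have E0 := expR_gt0 y.
have e1 : expR z = expR y * expR (z - y) by rewrite -expRD; congr expR; ring.
have e2 : expR y * expR (- y) = 1 by exact: expRxMexpNx_1.
rewrite e1.
move: (expR y) (expR (z - y)) (expR (- y)) h1 h2 E0 e2 => E F G h1 h2 E0 e2.
have a1 : 0 < y * (E * (F - (1 + (z - y)))) by rewrite !mulr_gt0// subr_gt0.
have a2 : 0 <= (z - y) * (E * (G - (1 - y))).
  by rewrite !mulr_ge0 ?subr_ge0// ltW.
have e3 : E * (G - (1 - y)) = 1 - E + E * y by rewrite mulrBr e2; ring.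
rewrite e3 in a2.
nra.
Qed.

(* Concavity of s |-> ln (1 - exp (- e^s)), written as a tangent line in ln y. *)
Lemma ln_1BexpRN_max m y : 0 < m -> 0 < y ->
  ln (1 - expR (- y)) - m / (expR m - 1) * ln y <= ln (1 - expR (- m)) - m / (expR m - 1) * ln m.
Proof.
move=> m0 y0.
pose w := m / (expR m - 1).
pose l (z : R) := ln (1 - expR (- z)) - w * ln z.
pose dl (z : R) := (expR z - 1)^-1 - w / z.
rewrite -/w -/(l y) -/(l m).
have ez0 z : 0 < z -> 0 < expR z - 1 by move=> z0; rewrite subr_gt0 expR_gt1.
have dlE (z : R) : 0 < z -> is_derive z 1 l (dl z).
  move=> z0; have p0 : 0 < 1 - expR (- z) by rewrite subr_gt0 expR_lt1 oppr_lt0.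
  have -> : dl z = (1 - expR (- z))^-1 * (0 - - expR (- z)) - w * z^-1.
    rewrite /dl sub0r opprK; congr (_ - _).
    have := ez0 _ z0; rewrite expRN; have := expR_gt0 z.
    move: (expR z) => x x0 x1; field.
    by rewrite (gt_eqF x0) (gt_eqF x1).
  apply: is_derive_funB; last by apply: is_derive_funZ; exact: is_derive1_ln.
  apply: (is_derive_fun_comp (f := @ln R) (g := fun z => 1 - expR (- z))).
    exact: is_derive1_ln.
  by apply: is_derive_funB; exact: is_derive_expRN.
(* By [expR_ratio], z/(e^z - 1) decreases, so [l] increases up to m and decreases afterwards. *)
have [ym|my|->//] := ltgtP y m; apply: ltW.
- apply: (is_derive_lt ym (df := dl)) => [z /andP[yz _]|z /andP[yz zm]].
    by apply: dlE; exact: lt_le_trans yz.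
  have z0 := lt_trans y0 yz.
  rewrite /dl /w subr_gt0 ltr_pdivrMr// [ltRHS]mulrC ltr_pdivlMr ?ez0// mulrAC ltr_pdivrMr ?ez0//.
  exact: expR_ratio.
- rewrite -ltrN2.
  apply: (is_derive_lt my (f := fun z => - l z) (df := fun z => - dl z)) => [z /andP[mz _]|z /andP[mz zy]].
    by apply: is_deriveN; apply: dlE; exact: lt_le_trans mz.
  have z0 := lt_trans m0 mz.
  rewrite /dl /w oppr_gt0 subr_lt0 ltr_pdivlMr// [ltLHS]mulrC ltr_pdivrMr ?ez0// mulrAC ltr_pdivlMr ?ez0//.
  exact: expR_ratio.
Qed.

(* |B_0 B_1| / |A_0 A_1| when u = ln |A_0|^2 and v = ln |A_1|^2 *)
Definition rprod u v : R := Num.sqrt ((1 - expR (- u)) * (1 - expR (- v))).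

Lemma oneBexpRN_itv u : 0 <= u -> 0 <= 1 - expR (- u) < 1.
Proof.
move=> u0; rewrite subr_ge0 -{1}expR0 ler_expR oppr_le0 u0/=.
by rewrite ltrBlDr ltrDl expR_gt0.
Qed.

(** For m = sqrt(u v), ln m is the midpoint of ln u and ln v. Adding the tangent bounds of
    [ln_1BexpRN_max] at u and v therefore cancels their linear terms. *)
Lemma rad_le u v : 0 <= u -> 0 <= v -> rprod u v <= 1 - expR (- Num.sqrt (u * v)).
Proof.
rewrite le_eqVlt => /predU1P[<- _|u0].
  by rewrite /rprod !mul0r !(oppr0, sqrtr0, expR0, subrr, mul0r).
rewrite le_eqVlt => /predU1P[<-|v0].
  by rewrite /rprod !(oppr0, mulr0, sqrtr0, expR0, subrr).
set m := Num.sqrt (u * v).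
have m0 : 0 < m by rewrite sqrtr_gt0 mulr_gt0.
have p0 z : 0 < z -> 0 < 1 - expR (- z) by move=> z0; rewrite subr_gt0 expR_lt1 oppr_lt0.
have lm : 2 * ln m = ln u + ln v.
  have <- : ln (m ^+ 2) = 2 * ln m by rewrite expr2 lnM ?posrE//; ring.
  by rewrite sqr_sqrtr ?lnM ?posrE// ltW// mulr_gt0.
have h1 := ln_1BexpRN_max m0 u0; have h2 := ln_1BexpRN_max m0 v0.
have h : ln ((1 - expR (- u)) * (1 - expR (- v))) <= ln ((1 - expR (- m)) ^+ 2).
  rewrite expr2 !lnM ?posrE ?p0//.
  have e : m / (expR m - 1) * (ln u + ln v) = m / (expR m - 1) * (2 * ln m) by rewrite lm.
  move: (ln (1 - expR (- u))) (ln (1 - expR (- v))) (ln (1 - expR (- m))) (m / (expR m - 1)) (ln m) (ln u) (ln v)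
    e h1 h2 => a b c k x y z.
  rewrite mulrDr; move: (k * y) (k * z) => ky kz; rewrite mulrCA; move: (k * x) => kx; clear.
  by lra.
have mm : 0 <= 1 - expR (- m) by rewrite ltW// p0.
rewrite /rprod -(ger0_norm mm) -sqrtr_sqr ler_wsqrtr// -ler_ln// posrE ?mulr_gt0 ?exprn_gt0 ?p0//.
Qed.

Lemma rad_itv u v : 0 <= u -> 0 <= v -> 0 <= rprod u v < 1.
Proof.
move=> u0 v0; rewrite sqrtr_ge0/=.
apply: le_lt_trans (rad_le u0 v0) _.
by have /andP[] := oneBexpRN_itv (sqrtr_ge0 (u * v)).
Qed.

Lemma le_ln_tangent (x y : R) : 0 < x -> 0 < y -> ln x <= ln y + (x - y) / y.
Proof.
move=> x0 y0; have := @le_ln1Dx R (x / y - 1).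
rewrite (_ : 1 + (x / y - 1) = x / y); last by ring.
rewrite ln_div ?posrE// mulrBl divff ?gt_eqF// => h.
rewrite -lerBlDl; apply: h.
by rewrite ltrBrDl subrr divr_gt0.
Qed.

Lemma sqrtM_le u v : 0 <= u -> 0 <= v -> 2 * Num.sqrt (u * v) <= u + v.
Proof.
move=> u0 v0; rewrite sqrtrM//.
have := sqr_ge0 (Num.sqrt u - Num.sqrt v); rewrite sqrrB !sqr_sqrtr//.
move=> h; rewrite -subr_ge0; apply: le_trans h _.
by rewrite le_eqVlt; apply/orP; left; apply/eqP; ring.
Qed.

Section comparison.
Variables u v : R.
Hypotheses (u0 : 0 <= u) (v0 : 0 <= v).
Let r := rprod u v.
Let b := Num.sqrt (u * v).
(** With c = cos(2 pi t): [w] is |1 + r e(t)|^2, [X] the logarithmic expression, and [Y] is |sqrt u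
    + sqrt v e(t)|^2. *)
Let w c := 1 + r ^+ 2 + 2 * r * c.
Let X c := u + v + ln (w c).
Let Y c := u + v + 2 * b * c.
Let h c := X c - Y c.

Let r0 : 0 <= r. Proof. exact: sqrtr_ge0. Qed.
Let r1 : r < 1. Proof. by have /andP[] := rad_itv u0 v0. Qed.

Lemma rprod_sqr_modulus_gt0 c : -1 <= c -> 0 < w c.
Proof.
move=> c1; have -> : w c = (1 - r) ^+ 2 + 2 * r * (c + 1) by rewrite /w; ring.
rewrite ltr_pwDl// ?exprn_gt0 ?subr_gt0// mulr_ge0 ?mulr_ge0//.
by rewrite -lerBlDr sub0r.
Qed.

Let X_mono c c' : -1 <= c -> c <= c' -> X c <= X c'.
Proof.
move=> c1 cc'; rewrite /X lerD2l ler_ln ?posrE ?rprod_sqr_modulus_gt0//; last exact: le_trans cc'.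
by rewrite /w lerD2l ler_wpM2l// mulr_ge0.
Qed.

(** Since w(-1) = (1 - r)^2, this is [rad_le] after taking logarithms. *)
Let hN1 : 0 <= h (-1).
Proof.
have -> : h (-1) = 2 * (ln (1 - r) + b).
  rewrite /h /X /Y (_ : w (-1) = (1 - r) ^+ 2); last by rewrite /w; ring.
  by rewrite expr2 lnM ?posrE ?subr_gt0//; ring.
rewrite mulr_ge0// -lerBlDr sub0r -[leLHS]expRK ler_ln ?posrE ?expR_gt0 ?subr_gt0//.
by have := rad_le u0 v0; rewrite -/r -/b lerBrDl -lerBrDr.
Qed.

Let Y_ge0 c : -1 <= c -> 0 <= Y c.
Proof.
move=> c1; have bb : 0 <= 2 * b by rewrite mulr_ge0// sqrtr_ge0.
have := sqrtM_le u0 v0; rewrite -/b => h1.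
have : 0 <= (2 * b) * (c + 1) by rewrite mulr_ge0// -lerBlDr sub0r.
rewrite /Y; move: (2 * b) bb h1 => B bb h1; rewrite mulrDr mulr1.
by lra.
Qed.

Let X_ge0 c : -1 <= c -> 0 <= X c.
Proof.
move=> c1; apply: le_trans (X_mono (lexx _) c1).
by apply: le_trans (Y_ge0 (lexx _)) _; rewrite -subr_ge0.
Qed.

(** [h] is concave and nonnegative at -1, and c is the convex combination of -1 and c' with weights
    (c' - c)/(c' + 1) and (c + 1)/(c' + 1). *)
Let h_between c c' : -1 <= c -> c < c' -> 0 <= h c' -> 0 <= h c.
Proof.
move=> c1 cc' hc'; have c'1 : 0 < c' + 1 by rewrite -ltrBlDr sub0r (le_lt_trans c1).
rewrite -(pmulr_rge0 _ c'1).
have W := rprod_sqr_modulus_gt0 c1.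
have t1 := le_ln_tangent (rprod_sqr_modulus_gt0 (lexx _)) W.
have t2 := le_ln_tangent (rprod_sqr_modulus_gt0 (ltW (le_lt_trans c1 cc'))) W.
have a1 : 0 <= c' - c by rewrite subr_ge0 ltW.
have a2 : 0 <= c + 1 by rewrite -lerBlDr sub0r.
apply: (@le_trans _ _ ((c' - c) * h (-1) + (c + 1) * h c')).
  by rewrite addr_ge0// mulr_ge0.
have := ler_wpM2l a1 t1; have := ler_wpM2l a2 t2.
rewrite -subr_ge0 => s2; rewrite -subr_ge0 => s1; rewrite -subr_ge0.
apply: le_trans (addr_ge0 s1 s2) _; rewrite le_eqVlt; apply/orP; left; apply/eqP.
rewrite /h /X /Y.
(* The linear terms of the two tangents cancel because [w] is affine. *)
have e : (c' - c) * ((w (-1) - w c) / w c) + (c + 1) * ((w c' - w c) / w c) = 0.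
  by rewrite !mulrA -mulrDl [X in X / _](_ : _ = 0) ?mul0r// /w; ring.
move: e; move: ((w (-1) - w c) / w c) ((w c' - w c) / w c) (ln (w (-1))) (ln (w c')) (ln (w c)).
move=> p q x y z e; apply/eqP; rewrite -subr_eq0 -e; apply/eqP; ring.
Qed.

(** By [h_between], the points of [-1, 1] where h >= 0 form an interval starting at -1; the crossing
    is its supremum. *)
Lemma exists_crossing : exists2 c0, -1 <= c0 & forall c, -1 <= c <= 1 ->
  (c < c0 -> 0 <= h c) /\ (c0 < c -> h c <= 0).
Proof.
pose S := [set c | -1 <= c <= 1 /\ 0 <= h c].
have S1 : S (-1) by split=> //; rewrite lexx/=; lra.
have hS : has_sup S by split; [exists (-1)|exists 1 => x [/andP[]]].
exists (sup S); first exact: (sup_upper_bound hS).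
move=> c /andP[c1 c2]; split=> [cS|Sc].
- have e0 : 0 < sup S - c by rewrite subr_gt0.
  have [c' [_ hc'] cc'] := sup_adherent e0 hS.
  by apply: h_between hc' => //; move: cc'; rewrite opprB addrC subrK.
- rewrite leNgt; apply/negP => hc; move: Sc; apply/negP; rewrite -leNgt.
  by apply: (sup_upper_bound hS); split; [rewrite c1|exact: ltW].
Qed.

(** Convexity gives Y^s >= X^s - s X^(s-1) h. The weight increases with c while [h] passes from + to
    -, so s X^(s-1) h <= k h with k the weight at the crossing. Finally h has mean at most 0 by
    [avg_ln_le0]. *)
Lemma avg_log_le (s : R) : 1 < s ->
  avg (fun t => (u + v + ln (1 + r ^+ 2 + 2 * r * cosc t)) `^ s) <=
  avg (fun t => (u + v + 2 * b * cosc t) `^ s).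
Proof.
move=> s1; have s0 : 0 < s by exact: lt_trans s1.
have [c0 c01 hc0] := exists_crossing.
pose k := s * X c0 `^ (s - 1).
have k0 : 0 <= k by rewrite mulr_ge0 ?powR_ge0// ltW.
have cw : continuous (fun t => ln (w (cosc t))).
  apply: continuous_ln_pos; last exact: continuous_affcosc.
  by move=> t; apply: rprod_sqr_modulus_gt0; have /andP[] := cosc_bound t.
have cX : continuous (fun t => X (cosc t) `^ s).
  apply: continuous_powR_ge0 => //.
    by move=> t; apply: X_ge0; have /andP[] := cosc_bound t.
  by move=> t; apply: cvgD; [exact: cvg_cst|exact: cw].
have cY : continuous (fun t => Y (cosc t) `^ s).
  apply: continuous_powR_ge0 => //; last exact: continuous_affcosc.
  by move=> t; apply: Y_ge0; have /andP[] := cosc_bound t.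
have cc : continuous (fun t => - (2 * b) * cosc t).
  by move=> t; apply: cvgM; [exact: cvg_cst|exact: continuous_cosc].
have ch : continuous (fun t => ln (w (cosc t)) + - (2 * b) * cosc t).
  by move=> t; apply: cvgD; [exact: cw|exact: cc].
have ckh : continuous (fun t => - k * (ln (w (cosc t)) + - (2 * b) * cosc t)).
  by move=> t; apply: cvgM; [exact: cvg_cst|exact: ch].
apply: (@le_trans _ _ (avg (fun t => X (cosc t) `^ s + - k * (ln (w (cosc t)) + - (2 * b) * cosc t)))).
  rewrite avgD// avgZ// avgD// avgZ ?avg_cosc ?mulr0 ?addr0; last exact: continuous_cosc.
  rewrite lerDl mulNr oppr_ge0 mulr_ge0_le0//.
  by apply: avg_ln_le0; rewrite r0.
apply: le_avg => //.
  by move=> t; apply: cvgD; [exact: cX|exact: ckh].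
move=> t; have cb := cosc_bound t; have /andP[cb1 cb2] := cb.
move: (cosc t) cb cb1 cb2 => c cb cb1 cb2.
apply: le_trans (powR_ge_tangent s1 (X_ge0 cb1) (Y_ge0 cb1)).
rewrite -/(X c) lerD2l.
have -> : ln (w c) + - (2 * b) * c = h c by rewrite /h /X /Y; ring.
have -> : Y c - X c = - h c by rewrite /h opprB.
rewrite mulNr mulrN lerN2.
have mono x y : 0 <= x -> x <= y -> s * x `^ (s - 1) <= s * y `^ (s - 1).
  move=> x0 xy; rewrite ler_wpM2l// ?(ltW s0)//; apply: ge0_ler_powR; rewrite ?nnegrE ?subr_ge0 ?(ltW s1)//.
  exact: le_trans xy.
have [h1 h2] := hc0 c cb.
have [cc0|c0c|->//] := ltgtP c c0.
- by apply: ler_wpM2r; [exact: h1|apply: mono; [exact: X_ge0|apply: X_mono => //; exact: ltW]].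
- by apply: ler_wnM2r; [exact: h2|apply: mono; [exact: X_ge0|apply: X_mono => //; exact: ltW]].
Qed.

Lemma log_ge0 t : 0 <= u + v + ln (1 + r ^+ 2 + 2 * r * cosc t).
Proof. by apply: X_ge0; have /andP[] := cosc_bound t. Qed.

End comparison.

End log_comparison.

(** Chains [avg_log_le] and [two_point] with s = q/2 and m = p/2. The condition on p and q, with
    [legN_le_central], yields the hypothesis [base] at T = 0. *)
Lemma nonlinear_two_point (R : realType) (p q u v : R) : 1 < p -> p < 2 -> 2 < q ->
  q^-1 * log2 (central_binomial q) <= p^-1 -> 0 <= u -> 0 <= v ->
  avg (fun t => (u + v + ln (1 + rprod u v ^+ 2 + 2 * rprod u v * cosc t)) `^ (q / 2)) <=
  (u `^ (p / 2) + v `^ (p / 2)) `^ (q / p).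
Proof.
move=> p1 p2 q2 pq u0 v0.
have s1 : 1 < q / 2 by lra.
have m12 : 1 < 2 * (p / 2) by lra.
have m1 : p / 2 < 1 by lra.
have [p0 q0] : 0 < p /\ 0 < q by lra.
have qp : q / 2 / (p / 2) = q / p by field; rewrite gt_eqF.
apply: (le_trans (avg_log_le u0 v0 s1)).
rewrite -qp; apply: two_point => //.
have := legN_le_central s1; rewrite (_ : 2 * (q / 2) = q); last by field.
have L1 : 0 < legN (q / 2) 1.
  by apply: lt_le_trans (legN_ge s1 (lexx _)); rewrite subrr mulr0 addr0.
have T0 : 0 < 2 `^ (q / 2) by rewrite powR_gt0.
have TL : 0 < 2 `^ (q / 2) * legN (q / 2) 1 by exact: mulr_gt0.
move=> h; have c0 := lt_le_trans TL h.
have ln2 : 0 < ln 2 :> R by rewrite ln_gt0// ltr1n.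
move: h; rewrite -ler_ln ?posrE// lnM ?posrE// ln_powR => h.
move: pq; rewrite /log2 mulrC ler_pdivrMr// ler_pdivrMr// => pq.
have {}h := le_trans h pq.
rewrite qp mulrBl lerBrDl; apply: (le_trans h).
by rewrite le_eqVlt; apply/orP; left; apply/eqP; field; rewrite gt_eqF.
Qed.

(** * Products in SU(1,1) *)

Section su11_algebra.
Context {R : realType}.
Local Open Scope complex_scope.
Implicit Types x y z A B C D : R[i].

Lemma complexReM x y : complex.Re (x * y) = complex.Re x * complex.Re y - complex.Im x * complex.Im y.
Proof. by case: x; case: y. Qed.

Lemma complexImM x y : complex.Im (x * y) = complex.Re x * complex.Im y + complex.Im x * complex.Re y.
Proof. by case: x; case: y. Qed.

Lemma normc_sq x : Normc.normc x ^+ 2 = complex.Re x ^+ 2 + complex.Im x ^+ 2.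
Proof. by case: x => a b /=; rewrite sqr_sqrtr// addr_ge0// sqr_ge0. Qed.

Lemma logsqE x : logsq x = ln (complex.Re x ^+ 2 + complex.Im x ^+ 2).
Proof. by rewrite /logsq normc_sq. Qed.

Lemma mx2M (a b c d a' b' c' d' : R[i]) : mx2 a b c d * mx2 a' b' c' d' =
  mx2 (a * a' + b * c') (a * b' + b * d') (c * a' + d * c') (c * b' + d * d').
Proof.
apply/matrixP => i j; rewrite [LHS]mxE !big_ord_recl big_ord0 addr0 !mxE /=.
by case: (i == 0); case: (j == 0).
Qed.

Lemma mx2_1 : mx2 1 0 0 1 = 1 :> 'M[R[i]]_2.
Proof.
apply/matrixP => i j; rewrite !mxE; case: i => [[|[|//]]] hi; case: j => [[|[|//]]] hj //.
Qed.

Lemma expiD (a b : R) : expi a * expi b = expi (a + b).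
Proof. by rewrite /expi; apply/eqP; rewrite eq_complex /= cosD sinD eqxx/= addrC eqxx. Qed.

Lemma expi0 : expi (0 : R) = 1.
Proof. by rewrite /expi cos0 sin0. Qed.

Lemma expi_conj (a : R) : (expi a)^* = expi (- a).
Proof. by rewrite /expi cosN sinN. Qed.

Lemma Dmx_inv (s : R) : (Dmx s)^-1 = Dmx (- s).
Proof.
have E : Dmx s * Dmx (- s) = 1.
  rewrite /Dmx mx2M !(mul0r, mulr0, addr0, add0r) !expiD mulrN opprK subrr addNr expi0.
  exact: mx2_1.
have [u _] := mulmx1_unit E.
by rewrite -[LHS]mulr1 -E mulKr.
Qed.

Lemma conjDE A B C D (s : R) : conjD (mx2 A B C D) s =
  mx2 A (B * expi (2 * pi * s)) (C * expi (- (2 * pi * s))) D.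
Proof.
rewrite /conjD Dmx_inv /Dmx !mx2M !(mul0r, mulr0, addr0, add0r) mulrN opprK.
rewrite (_ : 2 * pi * s = pi * s + pi * s) ?opprD -?expiD; last by ring.
have e : expi (pi * s) * expi (- (pi * s)) = 1 :> R[i] by rewrite expiD subrr expi0.
congr mx2; try ring.
- by rewrite mulrAC e mul1r.
- by rewrite mulrAC [expi (- _) * _]mulrC e mul1r.
Qed.

Lemma SU11_mul (G H : 'M[R[i]]_2) : SU11 G -> SU11 H -> SU11 (G * H).
Proof.
move=> [A [B [-> AB]]] [C [D [-> CD]]].
exists (A * C + B * D^*), (A * D + B * C^*); split.
  by rewrite mx2M; congr mx2; rewrite rmorphD !rmorphM/= ?conjcK addrC.
move: AB CD; rewrite !normc_sq; case: A => a a'; case: B => b b'; case: C => c c'; case: D => d d' /=.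
move=> AB CD; rewrite -[RHS]mulr1 -{1}AB -CD; ring.
Qed.

Lemma SU11_conjD (G : 'M[R[i]]_2) (s : R) : SU11 G -> SU11 (conjD G s).
Proof.
move=> [A [B [-> AB]]]; exists A, (B * expi (2 * pi * s)); split.
  by rewrite conjDE -expi_conj; congr mx2; rewrite rmorphM.
rewrite -AB; congr (_ - _); rewrite Normc.normcM exprMn (normc_sq (expi _))/=.
by rewrite cos2Dsin2 mulr1.
Qed.

Lemma SU11_norm (G : 'M[R[i]]_2) : SU11 G -> 1 <= complex.Re (G 0 0) ^+ 2 + complex.Im (G 0 0) ^+ 2.
Proof.
move=> [A [B [-> AB]]]; rewrite mxE /= -normc_sq -AB lerBlDr lerDl; exact: sqr_ge0.
Qed.

Lemma logsq_ge0 (G : 'M[R[i]]_2) : SU11 G -> 0 <= logsq (G 0 0).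
Proof. by move=> /SU11_norm h; rewrite logsqE ln_ge0. Qed.

(** The left side is Re((x + i y) e(s)). The argument of x + i y is taken as the arc cosine of x/p
    with the sign of y, and b is that angle over 2 pi. *)
Lemma polar (x y : R) : exists b : R, forall s : R,
  x * cosc s - y * sinc s = Num.sqrt (x ^+ 2 + y ^+ 2) * cosc (s + b).
Proof.
set p := Num.sqrt _.
have p2 : p ^+ 2 = x ^+ 2 + y ^+ 2 by rewrite sqr_sqrtr// addr_ge0// sqr_ge0.
have p0 : 0 <= p by exact: sqrtr_ge0.
suff [a xa ya] : exists2 a, x = p * cos a & y = p * sin a.
  exists (a / (2 * pi)) => s; rewrite {2}/cosc mulrDr.
  rewrite (_ : 2 * pi * (a / (2 * pi)) = a); last first.
    by rewrite mulrC divfK// mulf_neq0// gt_eqF// pi_gt0.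
  by rewrite cosD -/(cosc s) -/(sinc s) xa ya; ring.
move: p0; rewrite le_eqVlt => /predU1P[pe|p0].
  exists 0; rewrite -pe mul0r.
    by apply/eqP; rewrite -sqrf_eq0; apply/eqP; move: p2 (sqr_ge0 x) (sqr_ge0 y); rewrite -pe expr0n/=; lra.
  by apply/eqP; rewrite -sqrf_eq0; apply/eqP; move: p2 (sqr_ge0 x) (sqr_ge0 y); rewrite -pe expr0n/=; lra.
have pn : p != 0 by rewrite gt_eqF.
have xp : `|x| <= p by rewrite -(ger0_norm (ltW p0)) -ler_sqr ?nnegrE// !real_normK ?num_real// p2 lerDl sqr_ge0.
have x1 : -1 <= x / p <= 1.
  by rewrite ler_pdivlMr// ler_pdivrMr// mul1r mulN1r -ler_norml.
have [_ ca] := acos_def x1.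
have sa : p * sin (acos (x / p)) = `|y|.
  rewrite sin_acos// -{1}(ger0_norm (ltW p0)) -sqrtr_sqr -sqrtrM ?sqr_ge0//.
  rewrite -sqrtr_sqr; congr Num.sqrt; rewrite mulrBr mulr1 expr_div_n mulrC divfK ?expf_neq0//.
  by rewrite p2; ring.
have [y0|y0] := leP 0 y.
  by exists (acos (x / p)); rewrite ?ca ?sa ?ger0_norm// mulrC divfK.
exists (- acos (x / p)); first by rewrite cosN ca mulrC divfK.
by rewrite sinN mulrN sa ltr0_norm// opprK.
Qed.

Lemma norm_prod A B C D :
  complex.Re (A * C * (B * D^*)^*) ^+ 2 + complex.Im (A * C * (B * D^*)^*) ^+ 2 =
  (complex.Re A ^+ 2 + complex.Im A ^+ 2) * (complex.Re C ^+ 2 + complex.Im C ^+ 2) *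
  ((complex.Re B ^+ 2 + complex.Im B ^+ 2) * (complex.Re D ^+ 2 + complex.Im D ^+ 2)).
Proof. by case: A => a a'; case: B => b b'; case: C => c c'; case: D => d d' /=; ring. Qed.

(** Expansion of |a + b e(-t)|^2 with a = A C and b = B conj(D), where [c + i s] is e(t). *)
Lemma norm_sum A B C D (c s : R) : c ^+ 2 + s ^+ 2 = 1 ->
  complex.Re (A * C + B * (D^* * (c -i* s))) ^+ 2 + complex.Im (A * C + B * (D^* * (c -i* s))) ^+ 2 =
  (complex.Re A ^+ 2 + complex.Im A ^+ 2) * (complex.Re C ^+ 2 + complex.Im C ^+ 2) +
  (complex.Re B ^+ 2 + complex.Im B ^+ 2) * (complex.Re D ^+ 2 + complex.Im D ^+ 2) +
  2 * (complex.Re (A * C * (B * D^*)^*) * c - complex.Im (A * C * (B * D^*)^*) * s).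
Proof.
case: A => a a'; case: B => b b'; case: C => c1 c1'; case: D => d d' /= cs.
rewrite -[(b ^+ 2 + b' ^+ 2) * (d ^+ 2 + d' ^+ 2)]mulr1 -{1}cs.
by ring.
Qed.

(** The corner entry is A C + B conj(D) e(-s). As |B|^2 = |A|^2 - 1 and |D|^2 = |C|^2 - 1, the two
    terms have moduli in the ratio 1 to [rprod u v]; [b] absorbs their relative phase. *)
Lemma logsq_mul (G H : 'M[R[i]]_2) : SU11 G -> SU11 H -> exists b : R, forall s : R,
  let u := logsq (G 0 0) in let v := logsq (H 0 0) in
  logsq ((G * conjD H s) 0 0) = u + v + ln (1 + rprod u v ^+ 2 + 2 * rprod u v * cosc (s + b)).
Proof.
move=> sG sH; have uG := logsq_ge0 sG; have uH := logsq_ge0 sH.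
move: sG sH uG uH => [A [B [-> AB]]] [C [D [-> CD]]].
rewrite [mx2 A _ _ _ 0 0]mxE [mx2 C _ _ _ 0 0]mxE /= => uA uC.
pose z := A * C * (B * D^*)^*.
have [b hb] := polar (complex.Re z) (complex.Im z).
exists b => s.
set u := logsq A in uA *; set v := logsq C in uC *.
set nA := Normc.normc A ^+ 2; set nC := Normc.normc C ^+ 2.
have sb (x y : R) : x - y = 1 -> y = x - 1 by move=> <-; ring.
have nB := sb _ _ AB; have nD := sb _ _ CD; rewrite -/nA in nB; rewrite -/nC in nD.
have A1 : 1 <= nA by rewrite -subr_ge0 -nB sqr_ge0.
have C1 : 1 <= nC by rewrite -subr_ge0 -nD sqr_ge0.
have A0 : 0 < nA by exact: lt_le_trans A1.
have C0 : 0 < nC by exact: lt_le_trans C1.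
have eu : expR (- u) = nA^-1 by rewrite expRN lnK.
have ev : expR (- v) = nC^-1 by rewrite expRN lnK.
set r := rprod u v.
have r2 : r ^+ 2 = (1 - nA^-1) * (1 - nC^-1).
  by rewrite sqr_sqrtr ?eu ?ev// mulr_ge0 ?subr_ge0// invf_le1.
have zr : Num.sqrt (complex.Re z ^+ 2 + complex.Im z ^+ 2) = nA * nC * r.
  have nn : 0 <= nA * nC * r by rewrite mulr_ge0 ?sqrtr_ge0// ltW// mulr_gt0.
  rewrite -[RHS](ger0_norm nn) -sqrtr_sqr; congr Num.sqrt.
  rewrite -normc_sq /z exprMn r2.
  rewrite (_ : Normc.normc _ ^+ 2 = nA * nC * ((nA - 1) * (nC - 1))).
    by field; rewrite (gt_eqF A0) (gt_eqF C0).
  rewrite -nB -nD /nA /nC !normc_sq.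
  exact: norm_prod.
have key : complex.Re (A * C + B * (D^* * expi (- (2 * pi * s)))) ^+ 2
    + complex.Im (A * C + B * (D^* * expi (- (2 * pi * s)))) ^+ 2 =
    nA * nC * (1 + r ^+ 2 + 2 * r * cosc (s + b)).
  have -> : nA * nC * (1 + r ^+ 2 + 2 * r * cosc (s + b)) =
      nA * nC * (1 + r ^+ 2) + 2 * (nA * nC * r * cosc (s + b)) by ring.
  rewrite -zr -hb r2.
  have -> : nA * nC * (1 + (1 - nA^-1) * (1 - nC^-1)) = nA * nC + (nA - 1) * (nC - 1).
    by field; rewrite (gt_eqF A0) (gt_eqF C0).
  rewrite -nB -nD /nA /nC !normc_sq /expi cosN sinN -/(cosc s) -/(sinc s).
  by rewrite norm_sum// cos2Dsin2c.
have nn : nA * nC \in Num.pos by rewrite posrE mulr_gt0.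
have kk : 1 + r ^+ 2 + 2 * r * cosc (s + b) \in Num.pos.
  by rewrite posrE; apply: rprod_sqr_modulus_gt0 => //; have /andP[] := cosc_bound (s + b).
have [pA pC] : nA \in Num.pos /\ nC \in Num.pos by rewrite !posrE.
by rewrite conjDE mx2M mxE /= logsqE key (lnM nn kk) (lnM pA pC).
Qed.

End su11_algebra.

(** * A Minkowski step in one variable *)

Section one_step.
Context {R : realType}.

(** Convexity of x^k at (W + S)/(B + S), the combination of W/B and 1 with weights B/(B + S) and
    S/(B + S). Averaged with W^k of mean at most B^k, it gives Minkowski's inequality for W plus a
    constant. *)
Lemma powR_add_le (k W S B : R) : 1 < k -> 0 <= W -> 0 <= S -> 0 < B ->
  (W + S) `^ k <= (B + S) `^ k * (B / (B + S) * (W `^ k / B `^ k) + S / (B + S)).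
Proof.
move=> k1 W0 S0 B0; have BS : 0 < B + S by rewrite ltr_pwDl.
have q0 : 0 <= W / B by rewrite divr_ge0// ltW.
have y0 : 0 <= (W + S) / (B + S) by rewrite divr_ge0 ?addr_ge0// ltW.
have -> : W + S = (B + S) * ((W + S) / (B + S)) by rewrite mulrC divfK ?gt_eqF.
rewrite powRM ?(ltW BS)// ler_wpM2l ?powR_ge0//.
have t1 := powR_ge_tangent k1 y0 q0.
have t2 := powR_ge_tangent k1 y0 ler01.
have -> : W `^ k / B `^ k = (W / B) `^ k.
  rewrite powRM// ?invr_ge0 ?(ltW B0)//; congr (_ * _).
  by rewrite -[B^-1]powR_inv1 ?(ltW B0)// -powRrM mulN1r powRN.
rewrite powR1 in t2.
have a0 : 0 <= B / (B + S) by rewrite divr_ge0// ltW.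
have b0 : 0 <= S / (B + S) by rewrite divr_ge0// ltW.
apply: le_trans (lerD (ler_wpM2l a0 t1) (_ : S / (B + S) * _ <= S / (B + S))); last first.
  by have := ler_wpM2l b0 t2; rewrite mulr1; exact.
move: (_ `^ k) (_ `^ (k - 1)) => X Y.
rewrite le_eqVlt; apply/orP; left; apply/eqP.
by field; rewrite (gt_eqF BS) (gt_eqF B0).
Qed.

Variables p q : R.
Hypotheses (p1 : 1 < p) (p2 : p < 2) (q2 : 2 < q)
  (pq : q^-1 * log2 (central_binomial q) <= p^-1).

Let wt (u v t : R) := u + v + ln (1 + rprod u v ^+ 2 + 2 * rprod u v * cosc t).

Lemma continuous_logsq_powR u v a : 0 < a -> 0 <= u -> 0 <= v -> continuous (fun t => wt u v t `^ a).
Proof.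
move=> a0 u0 v0; apply: continuous_powR_ge0 => //; first by move=> t; exact: log_ge0.
move=> t; apply: cvgD; first exact: cvg_cst.
apply: (@continuous_ln_pos R (fun t => 1 + rprod u v ^+ 2 + 2 * rprod u v * cosc t)).
  by move=> x; apply: rprod_sqr_modulus_gt0 => //; have /andP[] := cosc_bound x.
exact: continuous_affcosc.
Qed.

Let p0 : 0 < p. Proof. exact: lt_trans p1. Qed.
Let q0 : 0 < q. Proof. exact: lt_trans q2. Qed.
Let k1 : 1 < q / p. Proof. by rewrite ltr_pdivlMr// mul1r (lt_trans p2). Qed.

Lemma continuous_minkowski_step u v S : 0 <= u -> 0 <= v -> 0 <= S ->
  continuous (fun t => (wt u v t `^ (p / 2) + S) `^ (q / p)).
Proof.
move=> u0 v0 S0; apply: continuous_powR_ge0; first exact: lt_trans k1.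
  by move=> t; rewrite addr_ge0// powR_ge0.
by move=> t; apply: cvgD; [apply: continuous_logsq_powR => //; rewrite divr_gt0|exact: cvg_cst].
Qed.

(** [nonlinear_two_point] bounds the L^(q/p) norm of wt^(p/2) by B, and [powR_add_le] adds the
    constant S. *)
Lemma avg_minkowski_step u v S : 0 <= u -> 0 <= v -> 0 <= S ->
  avg (fun t => (wt u v t `^ (p / 2) + S) `^ (q / p)) <=
  (u `^ (p / 2) + v `^ (p / 2) + S) `^ (q / p).
Proof.
move=> u0 v0 S0; set B := u `^ _ + v `^ _.
have k0 : 0 < q / p by exact: lt_trans k1.
have h20 : 0 < p / 2 by rewrite divr_gt0.
have B0 : 0 <= B by rewrite addr_ge0 ?powR_ge0.
have pow2 t : (wt u v t `^ (p / 2)) `^ (q / p) = wt u v t `^ (q / 2).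
  by rewrite -powRrM; congr powR; field; rewrite gt_eqF.
(* The case B = 0, where u = v = 0 and [wt] vanishes, is set apart because B becomes a
   denominator. *)
move: B0; rewrite le_eqVlt => /predU1P[B0|B0].
  have : B == 0 by rewrite -B0.
  rewrite paddr_eq0 ?powR_ge0// => /andP[/eqP/powR_eq0_eq0 ue /eqP/powR_eq0_eq0 ve].
  rewrite -B0 add0r -[leRHS]avg_cst le_eqVlt; apply/orP; left; apply/eqP.
  apply: eq_avg => t; rewrite /wt ue ve /rprod oppr0 expR0 subrr mul0r sqrtr0 expr0n/= !(mulr0, mul0r, addr0) ln1.
  by rewrite addr0 powR0 ?add0r// gt_eqF.
have main : avg (fun t => wt u v t `^ (q / 2)) <= B `^ (q / p).
  exact: nonlinear_two_point.
pose a := (B + S) `^ (q / p) * (B / (B + S)) / B `^ (q / p).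
pose b := (B + S) `^ (q / p) * (S / (B + S)).
have BS : 0 < B + S by rewrite ltr_pwDl.
have a0 : 0 <= a by rewrite !(mulr_ge0, invr_ge0, powR_ge0)// ltW.
have cw : continuous (fun t => wt u v t `^ (q / 2)) by apply: continuous_logsq_powR => //; rewrite divr_gt0.
have caw : continuous (fun t => a * wt u v t `^ (q / 2)).
  by move=> t; apply: cvgM; [exact: cvg_cst|exact: cw].
apply: (@le_trans _ _ (avg (fun t => a * wt u v t `^ (q / 2) + b))).
  apply: le_avg; [exact: continuous_minkowski_step| |].
    by move=> t; apply: cvgD; [exact: caw|exact: cvg_cst].
  move=> t; apply: (le_trans (powR_add_le k1 (powR_ge0 _ _) S0 B0)).
  by rewrite pow2 /a /b le_eqVlt; apply/orP; left; apply/eqP; ring.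
rewrite avgD//; last by move=> t; exact: cvg_cst.
rewrite avgZ// avg_cst.
apply: (le_trans (lerD (ler_wpM2l a0 main) (lexx b))).
have Bk : 0 < B `^ (q / p) by rewrite powR_gt0.
rewrite /a divfK ?gt_eqF// /b -mulrDr -mulrDl divff ?gt_eqF// mulr1//.
Qed.

End one_step.

(** * Induction on the torus *)

Section mx_measurable.
Context {R : realType} d {T : measurableType d}.
Implicit Types F G : T -> 'M[R[i]]_2.

(** Entrywise real and imaginary parts are what [logsqE] uses. *)
Definition mx_measurable F := forall i j,
  measurable_fun setT (fun t => complex.Re (F t i j)) /\
  measurable_fun setT (fun t => complex.Im (F t i j)).

Lemma complexReD (x y : R[i]) : complex.Re (x + y) = complex.Re x + complex.Re y.
Proof. by case: x; case: y. Qed.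

Lemma complexImD (x y : R[i]) : complex.Im (x + y) = complex.Im x + complex.Im y.
Proof. by case: x; case: y. Qed.

Lemma mx_measurable_cst A : mx_measurable (fun=> A).
Proof. by move=> i j; split; exact: measurable_cst. Qed.

Lemma mx_measurableM F G : mx_measurable F -> mx_measurable G ->
  mx_measurable (fun t => F t * G t).
Proof.
move=> mF mG i j.
have E t : (F t * G t) i j = F t i ord0 * G t ord0 j + F t i (lift ord0 ord0) * G t (lift ord0 ord0) j.
  by rewrite mxE !big_ord_recl big_ord0 addr0.
split.
- under eq_fun do rewrite E complexReD !complexReM.
  by apply: measurable_funD; apply: measurable_funB; apply: measurable_funM;
    first [exact: (mF _ _).1|exact: (mF _ _).2|exact: (mG _ _).1|exact: (mG _ _).2].
- under eq_fun do rewrite E complexImD !complexImM.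
  by apply: measurable_funD; apply: measurable_funD; apply: measurable_funM;
    first [exact: (mF _ _).1|exact: (mF _ _).2|exact: (mG _ _).1|exact: (mG _ _).2].
Qed.

Lemma mx_measurable_prod n (F : 'I_n -> T -> 'M[R[i]]_2) :
  (forall j, mx_measurable (F j)) -> mx_measurable (fun t => \prod_(j < n) F j t).
Proof.
elim: n F => [|n IH] F mF.
  by under eq_fun do rewrite big_ord0; exact: mx_measurable_cst.
under eq_fun do rewrite big_ord_recl.
by apply: mx_measurableM; [exact: mF|apply: IH => j; exact: mF].
Qed.

Lemma mx_measurable_Dmx (f : T -> R) : measurable_fun setT f -> mx_measurable (fun t => Dmx (f t)).
Proof.
move=> mf.
have mcos : measurable_fun setT (@cos R).
  by apply: continuous_measurable_fun; exact: continuous_cos.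
have msin : measurable_fun setT (@sin R).
  by apply: continuous_measurable_fun; exact: continuous_sin.
have mc (g : T -> R) : measurable_fun setT g -> measurable_fun setT (fun t => cos (g t)).
  by move=> mg; exact: (measurableT_comp mcos mg).
have ms (g : T -> R) : measurable_fun setT g -> measurable_fun setT (fun t => sin (g t)).
  by move=> mg; exact: (measurableT_comp msin mg).
have mp : measurable_fun setT (fun t => pi * f t) by exact: measurable_funM.
have mpN : measurable_fun setT (fun t => - (pi * f t)) by exact: measurableT_comp.
move=> i j; split; under eq_fun do rewrite mxE.
all: by case: (i == 0); case: (j == 0); first [exact: mc|exact: ms|exact: measurable_cst].
Qed.

Lemma measurable_logsq F k : mx_measurable F ->
  measurable_fun setT (fun t => (logsq (F t 0 0) `^ k)%:E).
Proof.
move=> mF; apply/measurable_EFinP.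
apply: (measurableT_comp (f := fun x : R => x `^ k)); first exact: measurable_powR.
under eq_fun do rewrite logsqE.
apply: (measurableT_comp (f := @ln R)); first exact: measurable_ln.
by apply: measurable_funD; apply: measurable_funX; [exact: (mF _ _).1|exact: (mF _ _).2].
Qed.

End mx_measurable.

(** * Peeling off the first variable *)

Section torus.
Context {R : realType}.

Lemma mx_measurable_transfer N (G : 'I_N.+1 -> 'M[R[i]]_2) :
  mx_measurable (fun t : N.-tuple (measurableTypeR R) => transfer G t).
Proof.
apply: mx_measurableM; first exact: mx_measurable_cst.
apply: mx_measurable_prod => j; rewrite /conjD.
under eq_fun do rewrite Dmx_inv.
apply: mx_measurableM; first apply: mx_measurableM; last first.
- apply: mx_measurable_Dmx.
  have mN : measurable_fun setT (fun x : R => - x).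
    by apply: continuous_measurable_fun => x; apply: cvgN; exact: cvg_id.
  exact: (measurableT_comp mN (measurable_tnth j)).
- exact: mx_measurable_cst.
- by apply: mx_measurable_Dmx; exact: measurable_tnth.
Qed.

(** Freezing t_1 = x leaves a transfer product of the same shape in the remaining variables, with
    these matrices. *)
Definition merge01 N (G : 'I_N.+2 -> 'M[R[i]]_2) (x : R) (j : 'I_N.+1) : 'M[R[i]]_2 :=
  if unlift ord0 j is Some k then G (lift ord0 (lift ord0 k))
  else G ord0 * conjD (G (lift ord0 ord0)) x.

Lemma transfer_tcons N (G : 'I_N.+2 -> 'M[R[i]]_2) (x : measurableTypeR R) (t : N.-tuple (measurableTypeR R)) :
  transfer G (tcons (x, t)) = transfer (merge01 G x) t.
Proof.
rewrite /transfer big_ord_recl mulrA /merge01 unlift_none tnth0; congr (_ * _).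
by apply: eq_bigr => j _; rewrite liftK tnthS.
Qed.

Lemma SU11_merge01 N (G : 'I_N.+2 -> 'M[R[i]]_2) x : (forall j, SU11 (G j)) ->
  forall j, SU11 (merge01 G x j).
Proof.
move=> hG j; rewrite /merge01; case: unliftP => [k _|_]; first exact: hG.
by apply: SU11_mul => //; exact: SU11_conjD.
Qed.

Lemma integral_circle (f : R -> R) : continuous f -> (forall t, 0 <= f t) ->
  (\int[circle_prob R]_t (f t)%:E = (avg f)%:E)%E.
Proof.
move=> cf f0; rewrite /circle_prob integral_uniform/=.
- by rewrite subr0 invr1 mul1e integral_EFin_avg.
- by apply/measurable_EFinP; exact: continuous_measurable_fun.
- by move=> t; rewrite lee_fin.
Qed.

Variables p q : R.
Hypotheses (p1 : 1 < p) (p2 : p < 2) (q2 : 2 < q)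
  (pq : q^-1 * log2 (central_binomial q) <= p^-1).

(** The q-th power of the theorem. The induction keeps [G] general, since merging changes the first
    matrix. *)
Lemma torus_bound N (G : 'I_N.+1 -> 'M[R[i]]_2) : (forall j, SU11 (G j)) ->
  (\int[torus_prob R N]_t (logsq (transfer G t 0 0) `^ (q / 2))%:E <=
   ((\sum_(j < N.+1) logsq (G j 0 0) `^ (p / 2)) `^ (q / p))%:E)%E.
Proof.
have p0 : 0 < p by exact: lt_trans p1.
elim: N G => [|N IH] G hG.
  rewrite /torus_prob /= integral_dirac//; last exact: measurable_logsq (mx_measurable_transfer _).
  rewrite diracT mul1e lee_fin big_ord_recl big_ord0 addr0 -powRrM.
  rewrite (_ : p / 2 * (q / p) = q / 2); last by field; rewrite gt_eqF.
  by rewrite /transfer big_ord0 mulr1.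
pose f t := (logsq (transfer G t 0 0) `^ (q / 2))%:E.
have mf : measurable_fun setT f := measurable_logsq _ (mx_measurable_transfer _).
have f0 t : (0 <= f t)%E by rewrite lee_fin powR_ge0.
rewrite /torus_prob /= ge0_integral_distribution//.
have mft : measurable_fun setT (f \o (@tcons _ _ N)).
  by apply: measurableT_comp => //; exact: measurable_tcons.
rewrite fubini_tonelli1//; last by move=> x; exact: f0.
have [b hb] := logsq_mul (hG ord0) (hG (lift ord0 ord0)).
pose u := logsq (G ord0 0 0); pose v := logsq (G (lift ord0 ord0) 0 0).
have u0 : 0 <= u := logsq_ge0 (hG _).
have v0 : 0 <= v := logsq_ge0 (hG _).
pose S := \sum_(j < N) logsq (G (lift ord0 (lift ord0 j)) 0 0) `^ (p / 2).
have S0 : 0 <= S by apply: sumr_ge0 => j _; exact: powR_ge0.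
pose g t := ((u + v + ln (1 + rprod u v ^+ 2 + 2 * rprod u v * cosc t)) `^ (p / 2) + S) `^ (q / p).
have cg : continuous g := continuous_minkowski_step p1 p2 q2 u0 v0 S0.
have cgb : continuous (fun t => g (t + b)).
  move=> t; apply: (@continuous_comp R R R (fun t => t + b) g); last exact: cg.
  by apply: cvgD; [exact: cvg_id|exact: cvg_cst].
apply: (@le_trans _ _ (\int[circle_prob R]_x (g (x + b))%:E)%E).
  apply: ge0_le_integral => //.
  - by move=> x _; apply: integral_ge0 => t _; exact: f0.
  - by apply: measurable_fun_fubini_tonelli_F => // x; exact: f0.
  - by apply/measurable_EFinP; exact: continuous_measurable_fun.
  (* For frozen x the induction hypothesis applies to the merged family; only its first summand
     depends on x, and [logsq_mul] turns the bound into g(x + b). *)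
  - move=> x _; rewrite /fubini_F.
    under eq_integral do rewrite /= /f transfer_tcons.
    apply: le_trans (IH _ (SU11_merge01 x hG)) _.
    rewrite lee_fin big_ord_recl {1}/merge01 unlift_none hb.
    under eq_bigr do rewrite /merge01 liftK.
    exact: lexx.
rewrite (integral_circle cgb); last by move=> t; exact: powR_ge0.
(* Periodicity removes the rotation by b. *)
have pg t : g (t + 1) = g t by rewrite /g coscD1.
rewrite (avg_shift b cg pg) lee_fin !big_ord_recl addrA.
exact: (avg_minkowski_step p1 p2 q2 pq u0 v0 S0).
Qed.

End torus.

Theorem corollary2 (R : realType) (p q : R)
    (hp1 : 1 < p) (hp2 : p < 2) (hq : 2 < q)
    (hpq : q^-1 * log2 (central_binomial q) <= p^-1)
    (N : nat) (hN : (1 <= N)%N)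
    (G : 'I_N.+1 -> 'M[R[i]]_2) (hG : forall j, SU11 (G j)) :
  ('N[torus_prob R N]_(q%:E)
      [(fun t => (logsq (transfer G t 0 0) `^ 2^-1)%:E)]
   <= ((\sum_(j < N.+1) logsq (G j 0 0) `^ (p / 2)) `^ p^-1)%:E)%E.
Proof.
have q0 : 0 < q by exact: lt_trans hq.
have p0 : 0 < p by exact: lt_trans hp1.
set S := \sum_(j < N.+1) _.
(* Both sides are now 1/q-th powers, so monotonicity reduces the claim to [torus_bound]. *)
have -> : S `^ p^-1 = (S `^ (q / p)) `^ q^-1.
  by rewrite -powRrM; congr powR; field; rewrite !gt_eqF.
rewrite unlock -poweR_EFin.
apply: gt0_ler_poweR.
- by rewrite invr_ge0 ltW.
- rewrite in_itv/= leey andbT.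
  by apply: integral_ge0 => t _; rewrite lee_fin powR_ge0.
- by rewrite in_itv/= leey andbT lee_fin powR_ge0.
rewrite (_ : (\int[_]_x _)%E = (\int[torus_prob R N]_t (logsq (transfer G t 0 0) `^ (q / 2))%:E)%E).
  exact: torus_bound.
apply: eq_integral => t _; rewrite abse_EFin poweR_EFin ger0_norm ?powR_ge0// -powRrM.
by rewrite [2^-1 * q]mulrC.
Qed.
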